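(* For all $F_1,F_2,F_3\in\mathcal{F}^{\mathrm{conv}}_{\mathbb{N}^*}$ and all $f_1,f_2,f_3\in\mathcal{F}^{\mathrm{conv}}_{\{x,y\}}$: $$(F_1\sqcup\!\sqcup_1F_2)\sqcup\!\sqcup_1F_3-F_1\sqcup\!\sqcup_1(F_2\sqcup\!\sqcup_1F_3)\in\ker(\zeta^T_{\mathrm{st}}),$$ $$(F_1\sqcup\!\sqcup_{-1}F_2)\sqcup\!\sqcup_{-1}F_3-F_1\sqcup\!\sqcup_{-1}(F_2\sqcup\!\sqcup_{-1}F_3)\in\ker(\zeta^{T,\star}_{\mathrm{st}}),$$ $$(f_1\sqcup\!\sqcup_0f_2)\sqcup\!\sqcup_0f_3-f_1\sqcup\!\sqcup_0(f_2\sqcup\!\sqcup_0f_3)\in\ker(\zeta^T_{\mathrm{sh}}).$$ That is, on convergent forests the images of the associators of the stuffle, anti-stuffle and shuffle products on trees lie in the kernels of the corresponding arborified zeta maps.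
   Context: $\mathbb{N}^*=\mathbb{Z}_{\ge1}$. A rooted forest is a finite (possibly empty) disjoint union of finite (non-planar) rooted trees; an $\Omega$-decorated forest carries a map from its vertex set to $\Omega$; forests are taken up to isomorphism. $\mathcal{F}_\Omega$ is the commutative unital $\mathbb{R}$-algebra freely generated by nonempty $\Omega$-decorated rooted trees: product is concatenation (disjoint union), unit is the empty forest $\emptyset$, forests form a basis. $|F|$ is the number of vertices of $F$. $B_+^\omega(F)$ is the tree obtained from $F$ by adding a new root decorated by $\omega$ joined to every root of $F$ (extended linearly in $F$). A leaf is a vertex without direct successor (child); a branching vertex has strictly more than one direct successor. $\lambda$-shuffle of trees. Let $(\Omega,\cdot)$ be a commutative semigroup and $\lambda\in\mathbb{R}$ (for $\lambda=0$, $\Omega$ may be any set). The bilinear product $\sqcup\!\sqcup_\lambda$ on $\mathcal{F}_\Omega$ is defined on forests by recursion on $|F|+|F'|$: (i) $\emptyset\sqcup\!\sqcup_\lambda F=F\sqcup\!\sqcup_\lambda\emptyset=F$; (ii) if $F=T_1\cdots T_k$, $F'=t_1\cdots t_n$ with all $T_i,t_j$ nonempty trees, $k,n\ge1$, $k+n\ge3$: $F\sqcup\!\sqcup_\lambda F'=\frac1{kn}\sum_{i=1}^k\sum_{j=1}^n(T_i\sqcup\!\sqcup_\lambda t_j)\,T_1\cdots\widehat{T_i}\cdots T_k\,t_1\cdots\widehat{t_j}\cdots t_n$ (hats denote omission); (iii) if $T=B_+^a(f)$, $T'=B_+^{a'}(f')$: $T\sqcup\!\sqcup_\lambda T'=B_+^a(f\sqcup\!\sqcup_\lambda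 T')+B_+^{a'}(T\sqcup\!\sqcup_\lambda f')+\lambda B_+^{a\cdot a'}(f\sqcup\!\sqcup_\lambda f')$. For $\Omega=\mathbb{N}^*$ the semigroup law is addition. The stuffle, anti-stuffle and shuffle products are the cases $\lambda=1,-1,0$; they preserve the spaces of convergent forests below. Series values. An $\mathbb{N}^*$-decorated forest is convergent if it is empty or all its roots have decoration $\ge2$; $\mathcal{F}^{\mathrm{conv}}_{\mathbb{N}^*}$ is their linear span. For $\lambda\in\{-1,0\}$ define $\mathcal{Z}_\lambda(F):\mathbb{N}^*\to\mathbb{R}$ by $\mathcal{Z}_\lambda(\emptyset)=1$, $\mathcal{Z}_\lambda(F_1F_2)=\mathcal{Z}_\lambda(F_1)\mathcal{Z}_\lambda(F_2)$, $\mathcal{Z}_\lambda(B_+^\alpha(F))(N)=\sum_{n=1}^{N+\lambda}n^{-\alpha}\mathcal{Z}_\lambda(F)(n)$ (empty sum $=0$). For convergent $F$, $\zeta^T_{\mathrm{st}}(F)=\lim_{N\to\infty}\mathcal{Z}_{-1}(F)(N)$ and $\zeta^{T,\star}_{\mathrm{st}}(F)=\lim_{N\to\infty}\mathcal{Z}_0(F)(N)$ (the limits exist), extended linearly. Integral values. A forest in $\mathcal{F}_{\{x,y\}}$ is convergent if all its leaves and branching vertices are decorated by $y$ and all its roots by $x$ (the empty forest is convergent); $\mathcal{F}^{\mathrm{conv}}_{\{x,y\}}$ is their linear span. With $\sigma_x(t)=1/t$, $\sigma_y(t)=1/(1-t)$ and $0<\epsilon<1$ define on $[\epsilon,1[$: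 $A_\epsilon(\emptyset)=1$, $A_\epsilon(F_1F_2)=A_\epsilon(F_1)A_\epsilon(F_2)$, $A_\epsilon(B_+^\omega(F))(z)=\int_\epsilon^z\sigma_\omega(t)A_\epsilon(F)(t)dt$. For convergent $F$, $\zeta^T_{\mathrm{sh}}(F)=\lim_{z\to1^-}\lim_{\epsilon\to0^+}A_\epsilon(F)(z)$ (the limits exist), extended linearly. *)

(* Defs.v *)
From HB Require Import structures.
From mathcomp Require Import all_boot all_order all_algebra finmap generic_quotient.
From mathcomp Require Import zify.
From mathcomp Require Import all_classical all_reals all_analysis.
(* The notations of monalg clash with those of mathcomp-analysis. *)
From mathcomp Require Import -(notations) monalg.

Set Implicit Arguments.
Unset Strict Implicit.
Unset Printing Implicit Defensive.

Import Order.TTheory GRing.Theory Num.Theory.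
Import numFieldNormedType.Exports.

Local Open Scope quotient_scope.
Local Open Scope classical_set_scope.
Local Open Scope ring_scope.

Notation "{ 'malg' R [ K ] }" := (malg K R)
  (at level 0, K, R at level 2, format "{ 'malg'  R [ K ] }") : type_scope.
Notation "{ 'cmonom' I }" := (cmonom I)
  (at level 0, I at level 2, format "{ 'cmonom'  I }") : type_scope.

(* Planar decorated rooted trees; the non-planar ones are obtained below as
   their isomorphism classes. *)
Inductive ptree (O : Type) : Type := PNode of O & seq (ptree O).

Fixpoint pfold (O A : Type) (g : O -> seq A -> A) (t : ptree O) : A :=
  let: PNode a l := t in g a (map (pfold g) l).

Section PlanarTreeChoice.
Variable O : Type.

Fixpoint ptree_ind_foldr (P : ptree O -> Prop)
    (IH : forall a l, foldr (fun t Q => P t /\ Q) True l -> P (PNode a l))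
    (t : ptree O) : P t :=
  let: PNode a l := t in
  IH a l ((fix F s : foldr (fun t Q => P t /\ Q) True s :=
    if s is u :: s' then conj (ptree_ind_foldr IH u) (F s') else I) l).

Definition ptree_code : ptree O -> GenTree.tree O :=
  pfold (fun a us => GenTree.Node 0 (GenTree.Leaf a :: us)).

Fixpoint ptree_decode (u : GenTree.tree O) : option (ptree O) :=
  if u is GenTree.Node _ (GenTree.Leaf a :: l)
  then Some (PNode a (pmap ptree_decode l)) else None.

Lemma ptree_codeK : pcancel ptree_code ptree_decode.
Proof.
elim/ptree_ind_foldr => a l IH /=; congr (Some (PNode a _)).
by elim: l IH => [|t l IHl] //= [-> /IHl ->].
Qed.

End PlanarTreeChoice.

HB.instance Definition _ (O : choiceType) :=
  Choice.copy (ptree O) (pcan_type (@ptree_codeK O)).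

Section Isomorphism.
Variable O : choiceType.
Implicit Types (t u v : ptree O) (l m : seq (ptree O)).

Fixpoint piso t u {struct t} : bool :=
  match t, u with
  | PNode a l, PNode b m =>
      (a == b) && has (fun p => all2 piso l p) (permutations m)
  end.

Lemma ptree_ind_in (P : ptree O -> Prop) :
  (forall a l, {in l, forall t, P t} -> P (PNode a l)) -> forall t, P t.
Proof.
move=> IH; elim/ptree_ind_foldr => a l Hl; apply: IH.
elim: l Hl => [|t l IHl] //= [Pt /IHl {}IHl] u; rewrite inE => /predU1P[->|] //.
exact: IHl.
Qed.

Lemma pisoP a l b m :
  reflect (a = b /\ exists2 p, perm_eq p m & all2 piso l p)
          (piso (PNode a l) (PNode b m)).
Proof.
apply: (iffP andP) => [[/eqP-> /hasP[p]]|[-> [p pm lp]]].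
  by rewrite mem_permutations => ? ?; split=> //; exists p.
by split=> //; apply/hasP; exists p; rewrite ?mem_permutations.
Qed.

Lemma all2_permr (r : rel (ptree O)) l p m :
  all2 r l p -> perm_eq p m -> exists2 q, perm_eq q l & all2 r q m.
Proof.
rewrite all2E => /andP[/eqP elp /allP /= rlp]; rewrite perm_sym.
case: p => [|t0 p'] in elp rlp *.
  by move/perm_size/size0nil ->; exists l => //; case: l elp {rlp}.
move: (t0 :: p') elp rlp => {p'} p elp rlp /(perm_iotaP t0)[Is eIs ->].
exists (map (nth t0 l) Is).
  by apply/(perm_iotaP t0); exists Is; rewrite ?elp.
rewrite all2E !size_map eqxx /=; apply/allP => -[x y] /=.
rewrite zip_map => /mapP[i iIs [-> ->]]; apply: (rlp (_, _)).
have ip : (i < size p)%N by rewrite (perm_mem eIs) mem_iota in iIs.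
by rewrite -nth_zip // mem_nth // size_zip elp minnn.
Qed.

Lemma piso_refl : reflexive piso.
Proof.
elim/ptree_ind_in => a l IH; apply/pisoP; split=> //; exists l => //.
rewrite all2E eqxx /=; apply/allP => -[x y] /=.
have -> : zip l l = map (fun x => (x, x)) l by elim: (l) => //= ? ? ->.
by move=> /mapP[z zl [-> ->]]; apply: IH.
Qed.

Lemma piso_sym : symmetric piso.
Proof.
have sub t u : piso t u -> piso u t.
  elim/ptree_ind_in: t u => a l IH [b m] /pisoP[<- [p pm lp]].
  have {lp pm}[q ql qm] := all2_permr lp pm.
  apply/pisoP; split=> //; exists q => //.
  have {ql}: {subset q <= l} by move=> x; rewrite (perm_mem ql).
  elim: q m qm => [|x q IHq] [|y m] //= /andP[xy qm] ql.
  rewrite IH ?ql ?mem_head //=; apply: IHq => // z zq.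
  by apply: ql; rewrite inE zq orbT.
by move=> t u; apply/idP/idP; apply: sub.
Qed.

Lemma piso_trans : transitive piso.
Proof.
move=> u t v; elim/ptree_ind_in: t u v => a l IH [b m] [c n].
move=> /pisoP[<- [p pm lp]] /pisoP[<- [q qn mq]].
rewrite perm_sym in pm.
have := @all2_permr (fun x y => piso y x) q m p.
have swap s1 s2 : all2 (fun x y => piso y x) s1 s2 = all2 piso s2 s1.
  by elim: s1 s2 => [|x s1 IHs] [|y s2] //=; rewrite IHs.
rewrite swap => /(_ mq pm)[q' q'q]; rewrite swap => pq'.
apply/pisoP; split=> //; exists q'; first exact: perm_trans qn.
have {IH}: {in l, forall t u v, piso t u -> piso u v -> piso t v} by [].
elim: l p q' {m q q'q mq qn pm swap} lp pq' => [|x l IHl] [|y p] [|z q'] //=.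
move=> /andP[xy lp] /andP[yz pq'] IH; rewrite (IH x _ y) ?mem_head //=.
by apply: IHl lp pq' _ => t tl; apply: IH; rewrite inE tl orbT.
Qed.

Canonical piso_equiv := EquivRel piso piso_refl piso_sym piso_trans.

End Isomorphism.

Definition tree (O : choiceType) : Type := {eq_quot (@piso O)}%qT.
HB.instance Definition _ (O : choiceType) := Choice.copy (tree O) {eq_quot (@piso O)}%qT.
HB.instance Definition _ (O : choiceType) := EqQuotient.copy (tree O) {eq_quot (@piso O)}%qT.

(* Forests are multisets of trees; the product of monomials is the disjoint
   union and mone is the empty forest. *)
Definition forest (O : choiceType) : Type := {cmonom (tree O)}.
HB.instance Definition _ (O : choiceType) :=
  ConomialDef.copy (forest O) {cmonom (tree O)}.

(* The commutative algebra freely generated by the decorated trees. *)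
Definition forest_alg (R : realType) (O : choiceType) : Type := {malg R[forest O]}.
HB.instance Definition _ (R : realType) (O : choiceType) :=
  GRing.ComAlgebra.copy (forest_alg R O) {malg R[forest O]}.

Section Forests.
Variable O : choiceType.
Implicit Types (T : tree O) (F : forest O) (s : seq (tree O)).

Definition trees F : seq (tree O) :=
  flatten [seq nseq (F T) T | T <- finsupp F].

Definition forest_of s : forest O := \big[mmul/mone]_(T <- s) ucm T.

Definition root T : O := let: PNode a _ := repr T in a.

Definition children T : forest O :=
  let: PNode _ l := repr T in forest_of [seq \pi_(tree O) t | t <- l].

Definition Bplus (a : O) F : tree O :=
  \pi_(tree O) (PNode a [seq repr T | T <- trees F]).

(* Only used with g invariant under permutations of its second argument, in
   which case tfold g (Bplus a F) = g a [seq tfold g T | T <- trees F]. *)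
Definition tfold (A : Type) (g : O -> seq A -> A) T : A := pfold g (repr T).

Definition tree_size : tree O -> nat := tfold (fun _ ns => (sumn ns).+1).

Definition forest_size F : nat := sumn [seq tree_size T | T <- trees F].

End Forests.

Section ForestTheory.
Variable O : choiceType.
Implicit Types (T : tree O) (F : forest O) (s : seq (tree O)).
Implicit Types (t : ptree O) (l m : seq (ptree O)).

Lemma count_trees F T : count_mem T (trees F) = F T.
Proof.
rewrite /trees count_flatten -map_comp sumnE big_map.
have [TF|TNF] := boolP (T \in finsupp F); last first.
  rewrite big_seq big1 => [|U UF]; first by rewrite memNfinsupp in TNF; rewrite (eqP TNF).
  by rewrite /= count_nseq /=; case: eqP UF TNF => // -> ->.
rewrite (big_fsetD1 T) //= count_nseq /= eqxx mul1n big_seq big1 ?addn0 // => U.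
by rewrite !inE => /andP[/negPf nUT _]; rewrite count_nseq /= nUT.
Qed.

Lemma forest_ofE s T : forest_of s T = count_mem T s.
Proof.
rewrite /forest_of; elim: s => [|U s IHs]; first by rewrite big_nil cm1.
by rewrite big_cons cmM cmU IHs.
Qed.

Lemma treesK : cancel (@trees O) (@forest_of O).
Proof. by move=> F; apply/eqP/cmP => T; rewrite forest_ofE count_trees. Qed.

Lemma perm_trees_forest_of s : perm_eq (trees (forest_of s)) s.
Proof. by apply/allP => T _ /=; rewrite count_trees forest_ofE. Qed.

Lemma perm_forest_of s s' : perm_eq s s' -> forest_of s = forest_of s'.
Proof. by move=> ss'; apply/eqP/cmP => T; rewrite !forest_ofE (permP ss'). Qed.

Lemma trees_ucm T : trees (ucm T) = [:: T].
Proof.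
have := perm_trees_forest_of [:: T]; rewrite /forest_of big_seq1.
exact/perm_small_eq.
Qed.

Lemma trees_mone : trees (mone : forest O) = [::].
Proof.
have := perm_trees_forest_of [::]; rewrite /forest_of big_nil.
by move/perm_nilP.
Qed.

Lemma perm_trees_mmul F F' : perm_eq (trees (mmul F F')) (trees F ++ trees F').
Proof. by apply/allP => T _ /=; rewrite count_cat !count_trees cmM. Qed.

Lemma pi_PNodeP a l b m :
  reflect (a = b /\ perm_eq (map \pi_(tree O) l) (map \pi_(tree O) m))
          (\pi_(tree O) (PNode a l) == \pi_(tree O) (PNode b m)).
Proof.
have pisoE t u : piso t u = (\pi_(tree O) t == \pi_(tree O) u).
  by rewrite (eqmodE (@piso_equiv O)).
have allE p q : all2 (@piso O) p q = (map \pi_(tree O) p == map \pi_(tree O) q).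
  by elim: p q => [|x p IHp] [|y q] //=; rewrite IHp eqseq_cons pisoE.
rewrite -pisoE; apply: (iffP (pisoP _ _ _ _)) => -[<-].
  by move=> [p pm]; rewrite allE => /eqP ->; split=> //; apply: perm_map.
move=> lm; split=> //; case: m lm => [|u m'] lm.
  by move/perm_nilP: lm => /=; case: l => // _; exists [::].
move: (u :: m') lm => {m'} m /(perm_iotaP (\pi_(tree O) u))[Is eIs lE].
exists (map (nth u m) Is).
  by apply/(perm_iotaP u); exists Is; rewrite // size_map in eIs *.
rewrite allE lE -map_comp; apply/eqP/eq_in_map => i.
by rewrite (perm_mem eIs) mem_iota size_map => im; rewrite /= (nth_map u).
Qed.

Lemma pi_repr_map s : map \pi_(tree O) (map repr s) = s.
Proof. by rewrite -map_comp map_id_in // => T _; exact: reprK. Qed.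

Lemma root_Bplus a F : root (Bplus a F) = a.
Proof.
rewrite /root /Bplus; have := reprK (Bplus a F); rewrite /Bplus.
by case: (repr _) => b m /eqP/pi_PNodeP[].
Qed.

Lemma children_Bplus a F : children (Bplus a F) = F.
Proof.
rewrite /children /Bplus; have := reprK (Bplus a F); rewrite /Bplus.
case: (repr _) => b m /eqP/pi_PNodeP[_]; rewrite pi_repr_map.
by move/perm_forest_of; rewrite treesK.
Qed.

Lemma Bplus_root_children T : Bplus (root T) (children T) = T.
Proof.
rewrite /root /children /Bplus; have := reprK T.
case: (repr T) => a m <-; apply/eqP/pi_PNodeP; split=> //.
rewrite pi_repr_map; exact: perm_trees_forest_of.
Qed.

Lemma tfold_Bplus (A : Type) (g : O -> seq A -> A) :
    (forall a (I : eqType) (h : I -> A) (r r' : seq I),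
       perm_eq r r' -> g a (map h r) = g a (map h r')) ->
  forall a F, tfold g (Bplus a F) = g a [seq tfold g T | T <- trees F].
Proof.
move=> gP; have pfoldP : forall t u, piso t u -> pfold g t = pfold g u.
  elim/ptree_ind_in => a l IH [b m] /pisoP[<- [p pm lp]] /=.
  rewrite -(gP _ _ _ _ _ pm); congr g.
  elim: l p lp IH {m pm} => [|x l IHl] [|y p] //= /andP[xy lp] IH.
  rewrite (IH _ _ _ xy) ?mem_head // (IHl p) // => z zl.
  by apply: IH; rewrite inE zl orbT.
move=> a F; rewrite /tfold /Bplus.
have : piso (repr (\pi_(tree O) (PNode a (map repr (trees F)))))
            (PNode a (map repr (trees F))).
  by rewrite -(eqmodE (@piso_equiv O)) reprK.
by move/pfoldP => -> /=; rewrite -map_comp.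
Qed.

Lemma tree_size_Bplus a F : tree_size (Bplus a F) = (forest_size F).+1.
Proof.
rewrite /tree_size tfold_Bplus // => _ I h r r' rr'.
by congr S; apply/perm_sumn/perm_map.
Qed.

Lemma forest_size_children T : (forest_size (children T)).+1 = tree_size T.
Proof. by rewrite -(tree_size_Bplus (root T)) Bplus_root_children. Qed.

Lemma tree_size_gt0 T : (0 < tree_size T)%N.
Proof. by rewrite -forest_size_children. Qed.

Lemma forest_size_ucm T : forest_size (ucm T) = tree_size T.
Proof. by rewrite /forest_size trees_ucm /= addn0. Qed.

End ForestTheory.

(* Linear extension of a map defined on the basis K. *)
Definition linext (R : pzRingType) (K : choiceType) (V : lmodType R)
    (f : K -> V) (g : {malg R[K]}) : V :=
  \sum_(k <- msupp g) mcoeff k g *: f k.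

Section Shuffle.
Variables (R : realType) (O : choiceType).
Variables (op : SemiGroup.com_law O) (lam : R).
Implicit Types (T : tree O) (F : forest O) (s : seq (tree O)).
Implicit Types (x y : forest_alg R O).

Definition basis F : forest_alg R O := mkmalgU F 1.

Definition BplusL (a : O) : forest_alg R O -> forest_alg R O :=
  linext (fun F => basis (ucm (Bplus a F))).

(* One unfolding of the recursive definition of the product sh. *)
Definition shuffle_step (sh : forest O -> forest O -> forest_alg R O) F F' :
    forest_alg R O :=
  match trees F, trees F' with
  | [::], _ => basis F'
  | _, [::] => basis F
  | [:: T], [:: T'] =>
      BplusL (root T) (sh (children T) F')
      + BplusL (root T') (sh F (children T'))
      + lam *: BplusL (op (root T) (root T')) (sh (children T) (children T'))
  | s, s' =>
      (size s * size s')%:R^-1 *: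
        \sum_(T <- s) \sum_(T' <- s')
          sh (ucm T) (ucm T') * basis (forest_of (rem T s ++ rem T' s'))
  end.

(* The recursive calls of shuffle_step decrease the total number of vertices,
   so that this many iterations reach the fixpoint: see shuffle_forestE. *)
Definition shuffle_forest F F' : forest_alg R O :=
  iter (forest_size F + forest_size F') shuffle_step (fun _ _ => basis mone) F F'.

Definition shuffle x y : forest_alg R O :=
  linext (fun F => linext (fun F' => shuffle_forest F F') y) x.

Definition associator x y z : forest_alg R O :=
  shuffle (shuffle x y) z - shuffle x (shuffle y z).

Lemma size_sum_trees s T T' s' : T \in s -> T' \in s' ->
  (3 <= size s + size s')%N ->
  (tree_size T + tree_size T' <
   sumn (map (@tree_size O) s) + sumn (map (@tree_size O) s'))%N.
Proof.
move=> Ts Ts'.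
have H r U : U \in r -> (tree_size U + (size r).-1 <=
    sumn (map (@tree_size O) r))%N.
  move=> Ur; rewrite (perm_sumn (perm_map _ (perm_to_rem Ur))) /= leq_add2l.
  rewrite -(size_rem Ur) {Ur}; elim: (rem U r) => //= V r' IH.
  by rewrite -add1n leq_add ?tree_size_gt0.
have := H _ _ Ts; have := H _ _ Ts'.
case: s s' Ts Ts' => [|? s] [|? s'] //= _ _; lia.
Qed.

Lemma forest_size_eq0 F : forest_size F = 0%N -> trees F = [::].
Proof.
rewrite /forest_size; case: (trees F) => //= T s; have := tree_size_gt0 T; lia.
Qed.

Lemma trees_nil F : trees F = [::] -> F = mone.
Proof. by move=> F0; rewrite -(treesK F) F0 /forest_of big_nil. Qed.

Lemma trees_seq1 F T : trees F = [:: T] -> F = ucm T.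
Proof. by move=> FT; rewrite -(treesK F) FT /forest_of big_seq1. Qed.

Lemma shuffle_step_ext (sh sh' : forest O -> forest O -> forest_alg R O) F F' :
  (forall G G', (forest_size G + forest_size G' < forest_size F + forest_size F')%N ->
     sh G G' = sh' G G') ->
  shuffle_step sh F F' = shuffle_step sh' F F'.
Proof.
move=> IH; rewrite /shuffle_step.
have big (s s' : seq (tree O)) : s = trees F -> s' = trees F' ->
    (3 <= size s + size s')%N ->
    \sum_(T <- s) \sum_(T' <- s')
      sh (ucm T) (ucm T') * basis (forest_of (rem T s ++ rem T' s')) =
    \sum_(T <- s) \sum_(T' <- s')
      sh' (ucm T) (ucm T') * basis (forest_of (rem T s ++ rem T' s')).
  move=> sE s'E s3; apply: eq_big_seq => T Ts.
  apply: eq_big_seq => T' Ts'; congr (_ * _); apply: IH.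
  by rewrite !forest_size_ucm /forest_size -sE -s'E size_sum_trees.
move: big; case FE: (trees F) => [|T [|U s]]; case F'E: (trees F') => [|T' [|U' s']] big.
- reflexivity.
- reflexivity.
- reflexivity.
- reflexivity.
- have FT : forest_size F = (forest_size (children T)).+1.
    by rewrite (trees_seq1 FE) forest_size_ucm forest_size_children.
  have FT' : forest_size F' = (forest_size (children T')).+1.
    by rewrite (trees_seq1 F'E) forest_size_ucm forest_size_children.
  have lt1 : (forest_size (children T) + forest_size F' < forest_size F + forest_size F')%N by lia.
  have lt2 : (forest_size F + forest_size (children T') < forest_size F + forest_size F')%N by lia.
  have lt3 : (forest_size (children T) + forest_size (children T')
      < forest_size F + forest_size F')%N by lia.
  by rewrite (IH _ _ lt1) (IH _ _ lt2) (IH _ _ lt3).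
- have h : (3 <= size [:: T] + size [:: T', U' & s'])%N by rewrite /= addnS.
  exact: (congr1 (GRing.scale _) (big _ _ erefl erefl h)).
- reflexivity.
- have h : (3 <= size [:: T, U & s] + size [:: T'])%N by rewrite /= addnS.
  exact: (congr1 (GRing.scale _) (big _ _ erefl erefl h)).
- have h : (3 <= size [:: T, U & s] + size [:: T', U' & s'])%N by rewrite /= !addnS.
  exact: (congr1 (GRing.scale _) (big _ _ erefl erefl h)).
Qed.

Lemma shuffle_forestE F F' :
  shuffle_forest F F' = shuffle_step (shuffle_forest) F F'.
Proof.
pose it n := iter n (shuffle_step) (fun _ _ => basis mone).
have it0 n G G' : (forest_size G + forest_size G' <= 0)%N -> it n G G' = basis mone.
  rewrite leqn0 addn_eq0 => /andP[/eqP/forest_size_eq0 G0].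
  move=> /eqP/forest_size_eq0/trees_nil G'0.
  by case: n => [|n]; [reflexivity|rewrite /it iterS /shuffle_step G0 G'0].
have indep n n' G G' : (forest_size G + forest_size G' <= n)%N ->
    (forest_size G + forest_size G' <= n')%N -> it n G G' = it n' G G'.
  elim: n n' G G' => [|n IHn] [|n'] G G' Gn Gn'.
  - reflexivity.
  - by rewrite (it0 0%N _ _ Gn) (it0 n'.+1 _ _ Gn).
  - by rewrite (it0 0%N _ _ Gn') (it0 n.+1 _ _ Gn').
  by apply: shuffle_step_ext => H H' HG; apply: IHn; lia.
have -> : shuffle_forest F F' = it (forest_size F + forest_size F').+1 F F'.
  exact: (indep _ _ F F' (leqnn _) (leqnSn _)).
by apply: shuffle_step_ext => G G' GF; exact: (indep _ _ G G' (ltnW GF) (leqnn _)).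
Qed.

Lemma shuffle_forest1l F : shuffle_forest mone F = basis F.
Proof. by rewrite shuffle_forestE /shuffle_step trees_mone. Qed.

Lemma shuffle_forest1r F : shuffle_forest F mone = basis F.
Proof.
rewrite shuffle_forestE /shuffle_step trees_mone.
case FE: (trees F) => [|T [|U s]]; [|reflexivity|reflexivity].
by rewrite (trees_nil FE).
Qed.

Lemma shuffle_forest_prod s s' :
  (0 < size s)%N -> (0 < size s')%N -> (3 <= size s + size s')%N ->
  shuffle_forest (forest_of s) (forest_of s') =
  (size s * size s')%:R^-1 *:
    \sum_(T <- s) \sum_(T' <- s')
      shuffle_forest (ucm T) (ucm T')
        * basis (forest_of (rem T s ++ rem T' s')).
Proof.
have := perm_trees_forest_of s; have := perm_trees_forest_of s'.
rewrite shuffle_forestE /shuffle_step.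
set r := trees (forest_of s); set r' := trees (forest_of s') => rs' rs.
rewrite -(perm_size rs) -(perm_size rs') -(perm_big _ rs) /= => r0 r'0 r3.
have -> : \sum_(T <- r) \sum_(T' <- s') shuffle_forest (ucm T) (ucm T')
        * basis (forest_of (rem T s ++ rem T' s')) =
    \sum_(T <- r) \sum_(T' <- r') shuffle_forest (ucm T) (ucm T')
        * basis (forest_of (rem T r ++ rem T' r')).
  apply: eq_big_seq => T Tr.
  rewrite -(perm_big _ rs') /=; apply: eq_big_seq => T' Tr'.
  congr (_ * basis _); apply: perm_forest_of.
  have permR (V : eqType) (x : V) (u v : seq V) :
      perm_eq u v -> x \in u -> perm_eq (rem x v) (rem x u).
    move=> uv xu; rewrite -(perm_cons x) perm_sym.
    rewrite -(permPl (perm_to_rem xu)) (permPl uv).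
    by apply: perm_to_rem; rewrite -(perm_mem uv).
  by rewrite perm_cat // permR.
by case: r r0 r3 {rs} => [|T [|U r]] //; case: r' r'0 {rs'} => [|T' [|U' r']].
Qed.

Lemma shuffle_forest_Bplus a b F F' :
  shuffle_forest (ucm (Bplus a F)) (ucm (Bplus b F')) =
    BplusL a (shuffle_forest F (ucm (Bplus b F')))
    + BplusL b (shuffle_forest (ucm (Bplus a F)) F')
    + lam *: BplusL (op a b) (shuffle_forest F F').
Proof.
by rewrite shuffle_forestE /shuffle_step !trees_ucm !root_Bplus !children_Bplus.
Qed.

End Shuffle.

Definition spanned (R : realType) (O : choiceType) (P : pred (forest O)) :
  set (forest_alg R O) := [set x | all P (msupp x)].

Definition posnat : Type := {n : nat | (0 < n)%N}.
HB.instance Definition _ := Countable.on posnat.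

Definition posnat_add (m n : posnat) : posnat :=
  exist _ (val m + val n)%N (ltn_addr (val n) (valP m)).

Lemma posnat_addA : associative posnat_add.
Proof. by move=> m n p; apply: val_inj; rewrite /= addnA. Qed.

Lemma posnat_addC : commutative posnat_add.
Proof. by move=> m n; apply: val_inj; rewrite /= addnC. Qed.

HB.instance Definition _ :=
  SemiGroup.isComLaw.Build posnat posnat_add posnat_addA posnat_addC.

Section SeriesValues.
Variable R : realType.

Definition conv_posnat (F : forest posnat) : bool :=
  all (fun T => 2 <= val (root T))%N (trees F).

(* Z_lam for lam <= 0: the sum ranges over 1 <= n <= N + lam. *)
Definition Ztree (lam : int) : tree posnat -> nat -> R :=
  tfold (fun (alpha : posnat) (zs : seq (nat -> R)) (N : nat) =>
    \sum_(1 <= n < N.+1 | n%:Z <= N%:Z + lam)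
      n%:R ^- val alpha * \prod_(z <- zs) z n).

Definition Zforest (lam : int) (F : forest posnat) (N : nat) : R :=
  \prod_(T <- trees F) Ztree lam T N.

Lemma Ztree_Bplus lam alpha F N :
  Ztree lam (Bplus alpha F) N =
    \sum_(1 <= n < N.+1 | n%:Z <= N%:Z + lam)
      n%:R ^- val alpha * Zforest lam F n.
Proof.
rewrite {1}/Ztree tfold_Bplus => [|a I h r r' rr'].
  by apply: eq_bigr => n _; rewrite big_map.
apply: boolp.funext => M; apply: eq_bigr => n _; congr (_ * _).
by apply: perm_big; apply: perm_map.
Qed.

Lemma Zforest_mone lam N : Zforest lam mone N = 1.
Proof. by rewrite /Zforest trees_mone big_nil. Qed.

Lemma Zforest_mmul lam F F' N :
  Zforest lam (mmul F F') N = Zforest lam F N * Zforest lam F' N.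
Proof. by rewrite /Zforest (perm_big _ (perm_trees_mmul F F')) big_cat. Qed.

Definition zeta_series (lam : int) : forest_alg R posnat -> R^o :=
  linext (fun F => limn (Zforest lam F) : R^o).

Definition zeta_st := zeta_series (-1).
Definition zeta_st_star := zeta_series 0.

Definition ker_zeta_st : set (forest_alg R posnat) :=
  [set x | spanned conv_posnat x /\ zeta_st x = 0].

Definition ker_zeta_st_star : set (forest_alg R posnat) :=
  [set x | spanned conv_posnat x /\ zeta_st_star x = 0].

End SeriesValues.

Inductive letter := letter_x | letter_y.

Definition letter_eqx (a : letter) : bool := if a is letter_x then true else false.
Definition letter_of (b : bool) : letter := if b then letter_x else letter_y.
Lemma letter_eqxK : cancel letter_eqx letter_of. Proof. by case. Qed.
HB.instance Definition _ := Countable.copy letter (can_type letter_eqxK).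

(* Any law would do: it only occurs in shuffle with coefficient lam = 0. *)
Definition letter_law (a b : letter) : letter :=
  if a is letter_x then b else letter_y.

Lemma letter_lawA : associative letter_law. Proof. by do 3!case. Qed.
Lemma letter_lawC : commutative letter_law. Proof. by do 2!case. Qed.
HB.instance Definition _ :=
  SemiGroup.isComLaw.Build letter letter_law letter_lawA letter_lawC.

Section IntegralValues.
Variable R : realType.
Notation mu := (@lebesgue_measure R).

(* The list bs runs over the children of the current vertex. *)
Definition leaves_branchings_y : tree letter -> bool :=
  tfold (fun (w : letter) (bs : seq bool) =>
    all id bs && (((size bs == 0) || (1 < size bs))%N ==> (w == letter_y))).

Definition conv_letter (F : forest letter) : bool :=
  all (fun T => (root T == letter_x) && leaves_branchings_y T) (trees F).

Definition sigma (w : letter) (t : R) : R :=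
  if w is letter_x then t^-1 else (1 - t)^-1.

Definition Atree (eps : R) : tree letter -> R -> R :=
  tfold (fun (w : letter) (fs : seq (R -> R)) (z : R) =>
    \int[mu]_(t in `[eps, z]) (sigma w t * \prod_(f <- fs) f t)).

Definition Aforest (eps : R) (F : forest letter) (z : R) : R :=
  \prod_(T <- trees F) Atree eps T z.

Lemma Atree_Bplus eps w F z :
  Atree eps (Bplus w F) z = \int[mu]_(t in `[eps, z]) (sigma w t * Aforest eps F t).
Proof.
rewrite {1}/Atree tfold_Bplus => [|a I h r r' rr'].
  by apply: eq_Rintegral => t _; rewrite big_map.
apply: boolp.funext => y; apply: eq_Rintegral => t _; congr (_ * _).
by apply: perm_big; apply: perm_map.
Qed.

Lemma Aforest_mone eps z : Aforest eps mone z = 1.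
Proof. by rewrite /Aforest trees_mone big_nil. Qed.

Lemma Aforest_mmul eps F F' z :
  Aforest eps (mmul F F') z = Aforest eps F z * Aforest eps F' z.
Proof. by rewrite /Aforest (perm_big _ (perm_trees_mmul F F')) big_cat. Qed.

Definition zeta_sh : forest_alg R letter -> R^o :=
  linext (fun F =>
    lim ((fun z => lim ((fun eps => Aforest eps F z) @ 0^'+)) @ 1^'-) : R^o).

Definition ker_zeta_sh : set (forest_alg R letter) :=
  [set x | spanned conv_letter x /\ zeta_sh x = 0].

End IntegralValues.

(* Main.v *)
From mathcomp Require Import all_boot all_order all_algebra finmap.
From mathcomp Require Import zify ring lra.
From mathcomp Require Import all_classical all_reals all_analysis.
From mathcomp Require Import -(notations) monalg.
Require Import Defs.

(** The three zeta maps are limits of truncated ones: finite nested sums up to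
    [N] for the series, and iterated integrals from [e] to [z],
    with [0 < e <= z < 1], for the integrals. Before passing to the limit every
    truncated map sends the shuffle of trees to the product of real numbers. On
    two trees this is the decomposition of a product of two sums over [n] and [m]
    into the parts [m < n], [n < m] and [n = m] ([truncated_sumM]; the weight of
    the diagonal is [+1] for strict and [-1] for large sums), respectively
    integration by parts ([Aforest_Baxter]). On forests it follows because the
    clause for several trees is an average of terms which all have the same
    value ([leval_shuffle]). As the product of real numbers is associative, every
    truncated map vanishes on every associator ([leval_associator]).

    Two facts remain. First, the shuffle of two convergent forests is a
    combination of convergent forests, so the associator lies in the domain of
    the zeta map. For decorations by positive integers only the roots matter. For
    the letters [x] and [y] one also needs that a vertex [x] keeps exactly one
    child, which follows by counting the trees in each term of a shuffle
    ([shuffle_forest_leaves_branchings_y]).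

    Secondly, the truncated values of each convergent forest converge, so that the
    limit of a linear combination is the linear combination of the limits.
    All truncated values are nonnegative and monotone in the truncation, so a
    uniform bound suffices. For the series, the truncated value of a forest with
    [k] vertices is at most [H_n ^ k], where [H_n] is the harmonic sum, and
    the sum of [H_n ^ k / n ^ 2] is bounded by Abel summation
    ([harmonic_sum_series_bound]). For the integrals, a tree whose leaves and
    branching vertices are [y] is at most [C t (1 - t) ^ (- d)] at [t], for each
    [0 < d <= 1] and with [C] independent of [e] ([Atree_bounded_by_powR]), and
    one more integration against [1 / t] at the root gives a bounded function. *)

Set Implicit Arguments.
Unset Strict Implicit.
Unset Printing Implicit Defensive.

Import Order.TTheory GRing.Theory Num.Theory.
Import numFieldNormedType.Exports.

Local Open Scope classical_set_scope.
Local Open Scope ring_scope.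

(** * Linear extension of a map on forests *)

Section LinearExtension.
Variables (R : realType) (O : choiceType) (V : lmodType R).
Implicit Types (f g : forest O -> V) (x y : forest_alg R O).

Lemma linextEw f x (d : {fset forest O}) : (msupp x `<=` d)%fset ->
  linext f x = \sum_(k <- d) mcoeff k x *: f k.
Proof.
move=> sd; rewrite /linext (big_fset_incl _ sd) // => k _ kx.
by rewrite mcoeff_outdom // scale0r.
Qed.

Lemma linextD f x y : linext f (x + y) = linext f x + linext f y.
Proof.
pose d := (msupp x `|` msupp y)%fset.
rewrite (@linextEw f x d) ?fsubsetUl // (@linextEw f y d) ?fsubsetUr //.
rewrite (@linextEw f _ d); last exact: (@msuppD_le _ _ x y).
by rewrite -big_split; apply: eq_bigr => k _; rewrite mcoeffD scalerDl.
Qed.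

Lemma linextZ f c x : linext f (c *: x) = c *: linext f x.
Proof.
rewrite (@linextEw f _ (msupp x)); last exact: (@msuppZ_le _ _ c x).
rewrite scaler_sumr; apply: eq_bigr => k _.
by rewrite (mcoeffZ c x) scalerA.
Qed.

Lemma linextB f x y : linext f (x - y) = linext f x - linext f y.
Proof. by rewrite linextD -(scaleN1r y) linextZ scaleN1r. Qed.

Lemma linext0 f : linext f 0 = 0.
Proof. by rewrite -(scale0r (0 : forest_alg R O)) linextZ scale0r. Qed.

Lemma linext_sum f (I : Type) (r : seq I) (P : pred I) (E : I -> forest_alg R O) :
  linext f (\sum_(i <- r | P i) E i) = \sum_(i <- r | P i) linext f (E i).
Proof. by apply: (big_morph _ (linextD f) (linext0 f)). Qed.

Lemma linext_basis f F : linext f (basis R F) = f F.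
Proof. by rewrite /linext /basis msuppU oner_eq0 big_seq_fset1 mcoeffUU scale1r. Qed.

End LinearExtension.

Lemma linext_comp (R : realType) (O : choiceType) (V : lmodType R)
    (f : forest O -> V) (g : forest O -> forest_alg R O) x :
  linext f (linext g x) = linext (fun F => linext f (g F)) x.
Proof. by rewrite linext_sum; apply: eq_bigr => F _; rewrite linextZ. Qed.

Lemma malgU_scale (R : realType) (O : choiceType) (c : R) (F : forest O) :
  mkmalgU F c = c *: basis R F :> forest_alg R O.
Proof.
apply/malgP => G; apply: (etrans (mcoeffU F c G)).
apply: (etrans _ (esym (@mcoeffZ (forest O) R c (basis R F) G))).
by rewrite [X in _ * X]mcoeffU mulr_natr.
Qed.

(** Values are read in the ring [R] itself rather than in its regular module,
    so that they can be multiplied. *)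
Definition leval (R : realType) (O : choiceType) (f : forest O -> R)
  (x : forest_alg R O) : R := linext (f : forest O -> R^o) x.

Section Evaluation.
Variables (R : realType) (O : choiceType).
Implicit Types (f g : forest O -> R) (x y : forest_alg R O).

Lemma levalE f x : leval f x = \sum_(F <- msupp x) mcoeff F x * f F.
Proof. by []. Qed.

Lemma levalD f x y : leval f (x + y) = leval f x + leval f y.
Proof. exact: (linextD (V := R^o)). Qed.

Lemma levalZ f c x : leval f (c *: x) = c * leval f x.
Proof. exact: (linextZ (V := R^o)). Qed.

Lemma levalB f x y : leval f (x - y) = leval f x - leval f y.
Proof. exact: (linextB (V := R^o)). Qed.

Lemma leval_sum f (I : Type) (r : seq I) (P : pred I) (E : I -> forest_alg R O) :
  leval f (\sum_(i <- r | P i) E i) = \sum_(i <- r | P i) leval f (E i).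
Proof. exact: (linext_sum (V := R^o)). Qed.

Lemma leval_basis f F : leval f (basis R F) = f F.
Proof. exact: (linext_basis (V := R^o)). Qed.

Lemma leval_linext f (g : forest O -> forest_alg R O) x :
  leval f (linext g x) = leval (fun F => leval f (g F)) x.
Proof. exact: (linext_comp (V := R^o)). Qed.

Lemma leval_mul f (fM : forall F F', f (mmul F F') = f F * f F') x y :
  leval f (x * y) = leval f x * leval f y.
Proof.
have -> : x * y = \sum_(k <- msupp x) \sum_(l <- msupp y)
    (mcoeff k x * mcoeff l y) *: basis R (mmul k l).
  rewrite [LHS]malgME; apply: eq_bigr => k _; apply: eq_bigr => l _.
  exact: malgU_scale.
rewrite leval_sum !levalE mulr_suml; apply: eq_bigr => k _.
rewrite leval_sum mulr_sumr; apply: eq_bigr => l _.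
by rewrite levalZ leval_basis fM mulrACA.
Qed.

End Evaluation.

(** * Spans of classes of forests *)

Section Spanned.
Variables (R : realType) (O : choiceType).
Implicit Types (P Q S : pred (forest O)) (x y : forest_alg R O).

Lemma spannedP P x : spanned P x <-> forall F, F \in msupp x -> P F.
Proof. by split=> [/allP|h]; [exact|apply/allP]. Qed.

Lemma spanned0 P : @spanned R O P 0.
Proof. by apply/spannedP => F; rewrite msupp0. Qed.

Lemma spannedD P x y : spanned P x -> spanned P y -> spanned P (x + y).
Proof.
move=> /spannedP Px /spannedP Py; apply/spannedP => F.
by move/(fsubsetP (msuppD_le x y)); rewrite inE => /orP[/Px|/Py].
Qed.

Lemma spannedZ P c x : spanned P x -> spanned P (c *: x).
Proof.
move=> /spannedP Px; apply/spannedP => F.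
by move/(fsubsetP (msuppZ_le c x)) => /Px.
Qed.

Lemma spannedB P x y : spanned P x -> spanned P y -> spanned P (x - y).
Proof. by move=> Px Py; rewrite -(scaleN1r y); apply/spannedD/spannedZ. Qed.

Lemma spanned_sum P (I : eqType) (r : seq I) (E : I -> forest_alg R O) :
  (forall i, i \in r -> spanned P (E i)) -> spanned P (\sum_(i <- r) E i).
Proof.
move=> PE; rewrite big_seq; elim/big_ind: _ => //; first exact: spanned0.
exact: spannedD.
Qed.

Lemma spanned_basis P F : P F -> spanned P (basis R F).
Proof.
by move=> PF; apply/spannedP => G; rewrite msuppU oner_eq0 inE => /eqP ->.
Qed.

Lemma spanned_linext P Q (f : forest O -> forest_alg R O) x :
  (forall F, P F -> spanned Q (f F)) -> spanned P x -> spanned Q (linext f x).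
Proof.
move=> PQ /spannedP Px; apply: spanned_sum => F /Px PF.
exact/spannedZ/PQ.
Qed.

Lemma spanned_mul P Q S x y : (forall F G, P F -> Q G -> S (mmul F G)) ->
  spanned P x -> spanned Q y -> spanned S (x * y).
Proof.
move=> PQS /spannedP Px /spannedP Qy; apply/spannedP => F.
by move=> /(fsubsetP (msuppM_incl x y))/imfset2P[/= G /Px PG [H /Qy QH ->]]; apply: PQS.
Qed.

Lemma spannedI P Q x : spanned P x -> spanned Q x -> spanned (predI P Q) x.
Proof.
by move=> /spannedP Px /spannedP Qx; apply/spannedP => F Fx /=; rewrite Px ?Qx.
Qed.

Lemma sub_spanned P Q x : subpred P Q -> spanned P x -> spanned Q x.
Proof. by move=> PQ /spannedP Px; apply/spannedP => F /Px/PQ. Qed.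

End Spanned.

(** * Induction on trees and along the shuffle product *)

Lemma tree_Bplus_ind (O : choiceType) (P : tree O -> Prop) :
  (forall a F, (forall T, T \in trees F -> P T) -> P (Bplus a F)) -> forall T, P T.
Proof.
move=> IH T; have [n] := ubnP (tree_size T); elim: n T => // n IHn T.
rewrite -[T]Bplus_root_children tree_size_Bplus ltnS => Tn.
apply: IH => U Uc; apply: IHn; apply: leq_trans Tn.
by rewrite /forest_size (perm_sumn (perm_map _ (perm_to_rem Uc))) /= ltnS leq_addr.
Qed.

Section ShuffleInduction.
Variables (R : realType) (O : choiceType) (op : SemiGroup.com_law O) (lam : R).
Implicit Types (T : tree O) (F : forest O) (x y z : forest_alg R O).
Notation sh := (shuffle_forest op lam).
Notation B := (@BplusL R O).

(** The recursive clauses of the shuffle product, read as an induction scheme: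
    to relate a shuffle to its two factors it suffices to do so clause by
    clause, assuming the relation for the shuffles that the clause calls. *)
Lemma shuffle_forest_ind (Q : forest O -> forest O -> forest_alg R O -> Prop) :
  (forall F, Q mone F (basis R F)) -> (forall F, Q F mone (basis R F)) ->
  (forall s s', (0 < size s)%N -> (0 < size s')%N -> (2 < size s + size s')%N ->
    {in s & s', forall T T', Q (ucm T) (ucm T') (sh (ucm T) (ucm T'))} ->
    Q (forest_of s) (forest_of s')
      ((size s * size s')%:R^-1 *: \sum_(T <- s) \sum_(T' <- s')
         sh (ucm T) (ucm T') * basis R (forest_of (rem T s ++ rem T' s')))) ->
  (forall a b F F',
    Q F (ucm (Bplus b F')) (sh F (ucm (Bplus b F'))) ->
    Q (ucm (Bplus a F)) F' (sh (ucm (Bplus a F)) F') ->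
    Q F F' (sh F F') ->
    Q (ucm (Bplus a F)) (ucm (Bplus b F'))
      (B a (sh F (ucm (Bplus b F'))) + B b (sh (ucm (Bplus a F)) F')
        + lam *: B (op a b) (sh F F'))) ->
  forall F F', Q F F' (sh F F').
Proof.
move=> Q1l Q1r Qprod QB F F'.
have [n] := ubnP (forest_size F + forest_size F'); elim: n F F' => // n IHn F F' Fn.
case FE: (trees F) (treesK F) => [|T s] <-.
  by rewrite -FE treesK (trees_nil FE) shuffle_forest1l.
case F'E: (trees F') (treesK F') => [|T' s'] <-.
  by rewrite -F'E treesK (trees_nil F'E) shuffle_forest1r.
have [s3|] := ltnP 2 (size (T :: s) + size (T' :: s')).
  rewrite shuffle_forest_prod //; apply: Qprod => // U U' Us Us'; apply: IHn.
  rewrite ltnS in Fn; apply: leq_trans Fn.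
  by rewrite !forest_size_ucm /forest_size FE F'E size_sum_trees.
move=> /= s2; have s0 : size s = 0%N by lia.
have s'0 : size s' = 0%N by lia.
move: FE F'E; rewrite {}(size0nil s0) {s'0}(size0nil s'0) => FE F'E {s2}.
rewrite /forest_of !big_seq1 in Fn *; move: Fn.
rewrite (trees_seq1 FE) (trees_seq1 F'E).
rewrite -[T]Bplus_root_children -[T']Bplus_root_children.
rewrite shuffle_forest_Bplus; move: (root T) (root T') (children T) (children T').
move=> a b {}F {F' FE F'E T T'} F'; rewrite !forest_size_ucm !tree_size_Bplus => Fn.
by apply: QB; apply: IHn; rewrite ?forest_size_ucm ?tree_size_Bplus; lia.
Qed.

(** * Characters of the shuffle product *)

(** The maps [phi i], for [i] in the domain [D], are multiplicative for the
    disjoint union. The index is needed because grafting mixes the truncations: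
    the value of a grafted tree at one index is an iterated sum or integral of
    values at other indices. [phiB] says that grafting acts on the values of a
    linear combination as a family over [D], and [phi_Baxter] is the
    Rota-Baxter identity of the operators through which grafting acts, written
    without naming them. *)
Section Evaluation.
Variables (I : Type) (D : set I) (phi : I -> forest O -> R).
Hypothesis phi1 : forall i, phi i mone = 1.
Hypothesis phiM : forall i F F', phi i (mmul F F') = phi i F * phi i F'.
Hypothesis phiB : forall a x y, (forall i, D i -> leval (phi i) x = leval (phi i) y) ->
  forall i, D i -> leval (phi i) (B a x) = leval (phi i) (B a y).
Hypothesis phi_Baxter : forall a b F F' i, D i ->
  phi i (ucm (Bplus a F)) * phi i (ucm (Bplus b F')) =
    phi i (ucm (Bplus a (mmul F (ucm (Bplus b F')))))
    + phi i (ucm (Bplus b (mmul (ucm (Bplus a F)) F')))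
    + lam * phi i (ucm (Bplus (op a b) (mmul F F'))).

Lemma phi_forest_of i s : phi i (forest_of s) = \prod_(T <- s) phi i (ucm T).
Proof. exact: (big_morph (phi i) (phiM i) (phi1 i)). Qed.

Lemma phi_ucm_rem i T s : T \in s ->
  phi i (ucm T) * phi i (forest_of (rem T s)) = phi i (forest_of s).
Proof.
by move=> Ts; rewrite !phi_forest_of (perm_big _ (perm_to_rem Ts)) big_cons.
Qed.

Lemma leval_BplusL_basis i a F : leval (phi i) (B a (basis R F)) = phi i (ucm (Bplus a F)).
Proof. by rewrite leval_linext !leval_basis. Qed.

(** In the clause for products of several trees, each of the [k n] pairs of trees
    contributes the full product of the two values, so the normalisation
    [1 / (k n)] is exactly right; in the clause for two trees the three terms
    are those of the Rota-Baxter identity. *)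
Lemma leval_shuffle_forest F F' i : D i -> leval (phi i) (sh F F') = phi i F * phi i F'.
Proof.
move: F F'; pose Q F F' x := forall i, D i -> leval (phi i) x = phi i F * phi i F'.
move=> F F'; move: F F' i; apply: (@shuffle_forest_ind Q).
- by move=> F i _; rewrite leval_basis phi1 mul1r.
- by move=> F i _; rewrite leval_basis phi1 mulr1.
- move=> s s' s0 s'0 _ IH i Di; rewrite levalZ leval_sum.
  (* Multiply by [k n] to clear the normalisation. *)
  have nz : (size s * size s')%:R != 0 :> R by rewrite pnatr_eq0 muln_eq0 !gtn_eqF.
  apply: (mulfI nz); rewrite mulVKf //.
  transitivity (\sum_(T <- s) \sum_(T' <- s') phi i (forest_of s) * phi i (forest_of s')).
    apply: eq_big_seq => T Ts; rewrite leval_sum; apply: eq_big_seq => T' Ts'.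
    rewrite leval_mul // leval_basis IH // phi_forest_of big_cat /=.
    by rewrite -!phi_forest_of mulrACA !phi_ucm_rem.
  by rewrite !big_const_seq !count_predT !iter_addr_0 -mulrnA mulr_natl mulnC.
- move=> a b F F' IH1 IH2 IH3 i Di; rewrite !levalD levalZ phi_Baxter //.
  have phiBx c x G : (forall j, D j -> leval (phi j) x = phi j G) ->
      leval (phi i) (B c x) = phi i (ucm (Bplus c G)).
    by move=> xG; rewrite -leval_BplusL_basis; apply: phiB => // j /xG ->; rewrite leval_basis.
  congr (_ + _ + _ * _); apply: phiBx => j Dj.
  - by rewrite IH1 // phiM.
  - by rewrite IH2 // phiM.
  - by rewrite IH3 // phiM.
Qed.

Lemma leval_shuffle x y i : D i ->
  leval (phi i) (shuffle op lam x y) = leval (phi i) x * leval (phi i) y.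
Proof.
move=> Di; rewrite leval_linext [leval (phi i) x]levalE mulr_suml levalE.
apply: eq_bigr => F _; rewrite leval_linext -mulrA; congr (_ * _).
rewrite !levalE mulr_sumr; apply: eq_bigr => F' _.
by rewrite leval_shuffle_forest // mulrCA.
Qed.

(** The shuffle product is not associative, but its image under [phi i] is the
    product of the field, which is. *)
Lemma leval_associator x y z i : D i -> leval (phi i) (associator op lam x y z) = 0.
Proof.
move=> Di; have sE u v := leval_shuffle u v Di.
apply: (etrans (levalB (phi i) _ _)); apply/eqP; rewrite subr_eq0; apply/eqP.
transitivity (leval (phi i) x * leval (phi i) y * leval (phi i) z).
  by rewrite -(sE x y); exact: sE.
by rewrite -mulrA -(sE y z); apply/esym; exact: sE.
Qed.

End Evaluation.

(** * Shuffles of convergent forests are convergent *)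

Lemma spanned_shuffle (P : pred (forest O)) x y :
  (forall F F', P F -> P F' -> spanned P (sh F F')) ->
  spanned P x -> spanned P y -> spanned P (shuffle op lam x y).
Proof.
move=> Psh Px Py; apply: spanned_linext Px => F PF.
by apply: spanned_linext Py => F' PF'; apply: Psh.
Qed.

Lemma spanned_associator (P : pred (forest O)) x y z :
  (forall F F', P F -> P F' -> spanned P (sh F F')) ->
  spanned P x -> spanned P y -> spanned P z ->
  spanned P (associator op lam x y z).
Proof. by move=> Psh Px Py Pz; apply: spannedB; do 2!apply: spanned_shuffle => //. Qed.

Lemma all_trees_mmul (p : pred (tree O)) F F' :
  all p (trees (mmul F F')) = all p (trees F) && all p (trees F').
Proof. by rewrite (perm_all _ (perm_trees_mmul F F')) all_cat. Qed.

Lemma all_trees_forest_of (p : pred (tree O)) s : all p (trees (forest_of s)) = all p s.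
Proof. exact: perm_all (perm_trees_forest_of s). Qed.

Lemma all_trees_ucm (p : pred (tree O)) T : all p (trees (ucm T)) = p T.
Proof. by rewrite trees_ucm /= andbT. Qed.

Lemma all_rem (p : pred (tree O)) T s : all p s -> all p (rem T s).
Proof. by move/allP => ps; apply/allP => U /mem_rem/ps. Qed.

Definition roots_in (p : pred O) F := all (fun T => p (root T)) (trees F).

Lemma spanned_roots_in_BplusL (p : pred O) a x : p a -> spanned (roots_in p) (B a x).
Proof.
move=> pa; apply: (@spanned_linext _ _ predT) => [F _|]; last exact/spannedP.
by apply: spanned_basis; rewrite /roots_in all_trees_ucm root_Bplus.
Qed.

(** Every root of a shuffle is a root of one of the factors or the product of two
    such roots. *)
Lemma shuffle_forest_roots_in (p : pred O) :
  (forall a b, p a -> p b -> p (op a b)) ->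
  forall F F', roots_in p F -> roots_in p F' -> spanned (roots_in p) (sh F F').
Proof.
move=> pop.
apply: (@shuffle_forest_ind (fun F F' x =>
  roots_in p F -> roots_in p F' -> spanned (roots_in p) x)).
- by move=> F _ pF; apply: spanned_basis.
- by move=> F pF _; apply: spanned_basis.
- move=> s s' _ _ _ IH; rewrite /roots_in !all_trees_forest_of => ps ps'.
  apply: spannedZ; apply: spanned_sum => T Ts; apply: spanned_sum => T' Ts'.
  apply: (@spanned_mul _ _ (roots_in p) (roots_in p)).
  + by move=> F G; rewrite /roots_in all_trees_mmul => -> ->.
  + by apply: IH; rewrite // /roots_in all_trees_ucm; [apply: (allP ps)|apply: (allP ps')].
  + by apply: spanned_basis; rewrite /roots_in all_trees_forest_of all_cat !all_rem.
- move=> a b F F' _ _ _ pa pb.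
  rewrite /roots_in all_trees_ucm root_Bplus in pa.
  rewrite /roots_in all_trees_ucm root_Bplus in pb.
  do 2?apply: spannedD; last apply: spannedZ; apply: spanned_roots_in_BplusL => //.
  exact: pop.
Qed.

End ShuffleInduction.

Section LetterShuffle.
Variable R : realType.
Notation sh := (shuffle_forest letter_law (0 : R)).
Implicit Types (F G : forest letter) (T : tree letter).

Definition leaves_branchings_y_in F := all leaves_branchings_y (trees F).

Lemma leaves_branchings_y_Bplus a F : leaves_branchings_y (Bplus a F) =
  leaves_branchings_y_in F && ((size (trees F) != 1%N) ==> (a == letter_y)).
Proof.
rewrite /leaves_branchings_y tfold_Bplus => [|b I h r r' rr'].
  rewrite all_map size_map; congr (_ && (_ ==> _)).
  by case: (size _) => [|[|n]].
by rewrite (perm_all _ (perm_map h rr')) !size_map (perm_size rr').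
Qed.

(** The number of trees in every term of the shuffle of forests with [k] and [n]
    trees: when both are nonempty, exactly one tree of each is merged into a
    single tree. *)
Definition joined_size (k n : nat) := if (k == 0) || (n == 0) then (k + n)%N else (k + n).-1.

Definition joined_forest F F' G := leaves_branchings_y_in G &&
   (size (trees G) == joined_size (size (trees F)) (size (trees F'))).

(** A vertex decorated by [x] has exactly one child. The shuffle replaces the forest
    of its children by the shuffle of a one-tree forest with one tree, and by the
    count of trees this is again a one-tree forest. The count must therefore be
    carried along in the induction. *)
Lemma shuffle_forest_leaves_branchings_y F F' :
  leaves_branchings_y_in F -> leaves_branchings_y_in F' ->
  spanned (joined_forest F F') (sh F F').
Proof.
move: F F'; apply: (@shuffle_forest_ind _ _ _ _ (fun F F' x =>
  leaves_branchings_y_in F -> leaves_branchings_y_in F' -> spanned (joined_forest F F') x)).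
- move=> F _ gF; apply: spanned_basis.
  by rewrite /joined_forest gF trees_mone /joined_size /= eqxx.
- move=> F gF _; apply: spanned_basis.
  by rewrite /joined_forest gF trees_mone /joined_size /= orbT addn0 eqxx.
- move=> s s' s0 s'0 _ IH; rewrite /leaves_branchings_y_in !all_trees_forest_of => ps ps'.
  apply: spannedZ; apply: spanned_sum => T Ts; apply: spanned_sum => T' Ts'.
  apply: (@spanned_mul _ _ (joined_forest (ucm T) (ucm T'))
    (fun G => leaves_branchings_y_in G && (size (trees G) == (size s).-1 + (size s').-1)%N)).
  + move=> G H; rewrite /joined_forest /leaves_branchings_y_in all_trees_mmul.
    move=> /andP[-> /eqP Gn] /andP[-> /eqP Hn] /=.
    rewrite (perm_size (perm_trees_mmul G H)) size_cat Gn Hn !trees_ucm.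
    rewrite !(perm_size (perm_trees_forest_of _)) /joined_size /=.
    case: (size s) (size s') s0 s'0 => [|n] [|m] //= _ _; apply/eqP; lia.
  + by apply: IH; rewrite // /leaves_branchings_y_in all_trees_ucm;
      [apply: (allP ps)|apply: (allP ps')].
  + apply: spanned_basis; rewrite /leaves_branchings_y_in all_trees_forest_of all_cat.
    by rewrite !all_rem //= (perm_size (perm_trees_forest_of _)) size_cat !size_rem.
- move=> a b F F' IH1 IH2 _.
  move=> gT gT'.
  rewrite /leaves_branchings_y_in all_trees_ucm in gT.
  rewrite /leaves_branchings_y_in all_trees_ucm in gT'.
  have gB c H x n : (0 < n)%N -> leaves_branchings_y (Bplus c H) ->
      spanned (fun G => leaves_branchings_y_in G && (size (trees G) == n)) x ->
      ((n == 1%N) || (size (trees H) != 1%N)) ->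
      spanned (joined_forest (ucm (Bplus a F)) (ucm (Bplus b F'))) (BplusL (R := R) c x).
    move=> n0; rewrite leaves_branchings_y_Bplus => /andP[gH cH] gx nH.
    apply: spanned_linext gx => G /andP[gG /eqP Gn].
    apply: spanned_basis; rewrite /joined_forest /leaves_branchings_y_in all_trees_ucm.
    rewrite !trees_ucm /= eqxx andbT leaves_branchings_y_Bplus gG Gn /=.
    case: eqP nH => //= _; exact: implyP.
  have gF : leaves_branchings_y_in F.
    by move: gT; rewrite leaves_branchings_y_Bplus => /andP[].
  have gF' : leaves_branchings_y_in F'.
    by move: gT'; rewrite leaves_branchings_y_Bplus => /andP[].
  rewrite scale0r addr0; apply: spannedD.
  + apply: (gB a F _ (joined_size (size (trees F)) 1)) => //.
    * by rewrite /joined_size; case: (size _) => [|n] //=; rewrite addn1.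
    * have := IH1 gF.
      by rewrite {1}/leaves_branchings_y_in all_trees_ucm /joined_forest trees_ucm; apply.
    * by rewrite /joined_size; case: (size _) => [|n] //=; rewrite addn1 /=; case: n.
  + apply: (gB b F' _ (joined_size 1 (size (trees F')))) => //.
    * by rewrite /joined_size; case: (size _) => [|n] //=.
    * have := IH2.
      by rewrite {1}/leaves_branchings_y_in all_trees_ucm /joined_forest trees_ucm; apply.
    * by rewrite /joined_size; case: (size _) => [|[|n]].
Qed.

Lemma conv_letterE F : conv_letter F =
  roots_in (pred1 letter_x) F && leaves_branchings_y_in F.
Proof. by rewrite /conv_letter all_predI. Qed.

Lemma shuffle_forest_conv_letter F F' : conv_letter F -> conv_letter F' ->
  spanned (@conv_letter) (sh F F').
Proof.
rewrite !conv_letterE => /andP[rF gF] /andP[rF' gF'].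
have rsh : spanned (roots_in (pred1 letter_x)) (sh F F').
  by apply: shuffle_forest_roots_in => // a b /eqP-> /eqP->.
apply: sub_spanned (spannedI rsh (shuffle_forest_leaves_branchings_y gF gF')).
by move=> G /andP[rG /andP[gG _]]; rewrite conv_letterE rG.
Qed.
End LetterShuffle.

Lemma shuffle_forest_conv_posnat (R : realType) (lam : R) F F' :
  conv_posnat F -> conv_posnat F' -> spanned conv_posnat (shuffle_forest posnat_add lam F F').
Proof.
apply: (@shuffle_forest_roots_in _ _ _ _ (fun n : posnat => 1 < val n)%N) => m n /= m1 n1.
exact: ltn_addr.
Qed.

(** * Limits of linear combinations *)

Lemma cvg_sum_seq (R : realType) (T : Type) (G : set_system T) (FG : Filter G)
    (I : eqType) (r : seq I) (f : I -> T -> R) (l : I -> R) :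
  (forall i, i \in r -> f i t @[t --> G] --> l i) ->
  \sum_(i <- r) f i t @[t --> G] --> \sum_(i <- r) l i.
Proof.
have P0 : \sum_(i <- [::]) f i t @[t --> G] --> \sum_(i <- [::]) l i.
  by rewrite big_nil; under eq_cvg do rewrite big_nil; exact: cvg_cst.
elim: r => [//|i r IH] fl; rewrite big_cons; under eq_cvg do rewrite big_cons.
apply: cvgD; first by apply: fl; rewrite mem_head.
by apply: IH => j jr; apply: fl; rewrite inE jr orbT.
Qed.

Lemma leval_cvg (R : realType) (O : choiceType) (T : Type) (G : set_system T)
    (FG : Filter G) (u : forest O -> T -> R) (l : forest O -> R) (x : forest_alg R O) :
  (forall F, F \in msupp x -> u F t @[t --> G] --> l F) ->
  leval (u ^~ t) x @[t --> G] --> leval l x.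
Proof.
move=> ul; apply: cvg_sum_seq => F /ul uF; exact: cvgMl_tmp.
Qed.

(** * Truncated sums *)

Section TruncatedSums.
Variable R : realType.
Implicit Types (f g : nat -> R) (b : bool).

Lemma sum1_recr f M : (0 < M)%N -> \sum_(1 <= n < M.+1) f n = \sum_(1 <= n < M) f n + f M.
Proof. exact: big_nat_recr. Qed.

(** Splitting a double sum according to the order of the two indices. The boolean
    tells whether the inner sums are strict: strict sums omit the diagonal, which
    has to be added, and large sums count it twice, so it has to be subtracted. *)
Lemma truncated_sumM b f g M :
  (\sum_(1 <= n < M) f n) * (\sum_(1 <= n < M) g n) =
    \sum_(1 <= n < M) f n * (\sum_(1 <= m < n + ~~ b) g m)
    + \sum_(1 <= n < M) g n * (\sum_(1 <= m < n + ~~ b) f m)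
    + (-1) ^+ (~~ b) * \sum_(1 <= n < M) f n * g n.
Proof.
elim: M => [|[|M] IH]; do 1?by rewrite !big_geq // mul0r mulr0 !addr0.
rewrite !(@sum1_recr _ M.+1) // mulrDl !mulrDr {}IH.
by case: b; rewrite /= ?addn0 ?addn1 ?expr0 ?expr1 ?(@sum1_recr _ M.+1) //; ring.
Qed.

Definition harmonic_sum N : R := \sum_(1 <= n < N.+1) n%:R^-1.

Lemma harmonic_sum_ge0 N : 0 <= harmonic_sum N.
Proof. by apply: sumr_ge0 => n _; rewrite invr_ge0 ler0n. Qed.

Lemma harmonic_sumS N : harmonic_sum N.+1 = harmonic_sum N + N.+1%:R^-1.
Proof. exact: sum1_recr. Qed.

Lemma le_harmonic_sum : {homo harmonic_sum : m n / (m <= n)%N >-> m <= n}.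
Proof.
apply: homo_leq => // [x y z|N]; first exact: le_trans.
by rewrite harmonic_sumS lerDl invr_ge0 ler0n.
Qed.

Lemma exprB_le (x y : R) k : 0 <= y -> y <= x ->
  x ^+ k.+1 - y ^+ k.+1 <= k.+1%:R * x ^+ k * (x - y).
Proof.
move=> y0 yx; rewrite subrXX mulrC ler_wpM2r ?subr_ge0 //.
apply: (@le_trans _ _ (\sum_(i < k.+1) x ^+ k)); last by rewrite sumr_const card_ord mulr_natl.
apply: ler_sum => i _; rewrite /=.
have -> : x ^+ k = x ^+ (k - i) * x ^+ i by rewrite -exprD subnK // -ltnS.
rewrite ler_wpM2l ?exprn_ge0 ?(le_trans y0) //.
by rewrite lerXn2r // nnegrE (le_trans y0).
Qed.

Lemma invr_sqr_le_telescope n : (0 < n)%N ->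
  n%:R ^- 2 <= 2 * n%:R^-1 - 2 * n.+1%:R^-1 :> R.
Proof.
move=> n0; have n1 : 1 <= n%:R :> R by rewrite ler1n.
rewrite -(natr1 n); set x : R := n%:R in n1 *.
have x0 : x != 0 by lra.
have x1 : x + 1 != 0 by lra.
have -> : 2 * x^-1 - 2 * (x + 1)^-1 = 2 / (x * (x + 1)).
  by field; rewrite ?x0 ?x1.
rewrite ler_pdivlMr ?mulr_gt0 //; try lra.
rewrite mulrC ler_pdivrMr ?exprn_gt0; try lra.
by rewrite expr2; nra.
Qed.

(** Abel summation against the telescoping majorant of [n ^- 2] lowers the power of
    the harmonic sum by one. Including the boundary term
    [2 / (N + 1) * H_N ^+ k] in the bounded quantity makes the summation by parts
    a plain induction on [N]. *)
Lemma harmonic_sum_series_bound k : exists C, forall N,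
  \sum_(1 <= n < N.+1) n%:R ^- 2 * harmonic_sum n ^+ k <= C.
Proof.
suff [C HC] : exists C, forall N, \sum_(1 <= n < N.+1) n%:R ^- 2 * harmonic_sum n ^+ k
    + 2 * N.+1%:R^-1 * harmonic_sum N ^+ k <= C.
  exists C => N; apply: le_trans (HC N); rewrite lerDl !mulr_ge0 ?invr_ge0 //.
  by rewrite exprn_ge0 ?harmonic_sum_ge0.
have tele n x : 0 <= x -> n.+1%:R ^- 2 * x + 2 * n.+2%:R^-1 * x <= 2 * n.+1%:R^-1 * x :> R.
  by move=> x0; rewrite -mulrDl ler_wpM2r // -lerBrDr invr_sqr_le_telescope.
elim: k => [|k [C HC]].
  exists 2; elim=> [|N IH]; first by rewrite big_geq // add0r expr0 invr1 !mulr1.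
  rewrite sum1_recr // -addrA expr0; apply: le_trans IH; rewrite lerD2l expr0.
  exact: tele.
exists (2 * k.+1%:R * C) => N.
apply: (@le_trans _ _ (2 * k.+1%:R * \sum_(1 <= n < N.+1) n%:R ^- 2 * harmonic_sum n ^+ k)).
  elim: N => [|N IH].
    by rewrite !big_geq // /harmonic_sum big_geq // expr0n /= !mulr0 addr0.
  rewrite !(@sum1_recr _ N.+1) //.
  set h := harmonic_sum N.+1; set h' := harmonic_sum N in IH.
  have hh' : h - h' = N.+1%:R^-1 by rewrite /h harmonic_sumS addrC addKr.
  (* With [p = 1 / (N + 1)], the term left over by the summation by parts is
     [2 p (h ^+ k.+1 - h' ^+ k.+1)], at most [2 (k + 1) p ^+ 2 h ^+ k]. *)
  have := @exprB_le h h' k (harmonic_sum_ge0 _).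
  rewrite hh' => /(_ (le_harmonic_sum (leqnSn N))).
  have p0 : 0 <= N.+1%:R^-1 :> R by rewrite invr_ge0.
  move=> /(ler_wpM2l p0).
  have h0 : 0 <= h ^+ k.+1 by rewrite exprn_ge0 ?harmonic_sum_ge0.
  have := tele N _ h0; move: IH; rewrite -exprVn expr2.
  move: (N.+1%:R^-1) (N.+2%:R^-1) (h ^+ k.+1) (h' ^+ k.+1) (h ^+ k) (k.+1%:R : R).
  move=> p q A B D c.
  move: (\sum_(_ <= _ < _) _) (\sum_(_ <= _ < _) _) => U V.
  lra.
rewrite ler_wpM2l // ?mulr_ge0 //; apply: le_trans (HC N).
by rewrite lerDl !mulr_ge0 ?invr_ge0 // exprn_ge0 ?harmonic_sum_ge0.
Qed.

End TruncatedSums.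

(** * Series values *)

(** [b = true] is the strict case, with the stuffle product, and [b = false] the
    large case, with the anti-stuffle product. *)
Section ZetaSeries.
Variables (R : realType) (b : bool).
Let l : int := if b then -1 else 0.
Implicit Types (F : forest posnat) (T : tree posnat) (a : posnat).
Notation Zf := (@Zforest R l).
Notation Zt := (@Ztree R l).

Lemma Ztree_BplusE a F N :
  Zt (Bplus a F) N = \sum_(1 <= n < N + ~~ b) n%:R ^- val a * Zf F n.
Proof.
rewrite Ztree_Bplus -/l big_mkcond /= /l; case: (b) => /=.
  rewrite addn0; case: N => [|N]; first by rewrite !big_geq.
  rewrite big_nat_recr //= ifF; last by apply/negbTE; lia.
  rewrite addr0; apply: eq_big_nat => n nN; rewrite ifT //; lia.
rewrite addn1; apply: eq_big_nat => n nN; rewrite ifT //; lia.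
Qed.

Lemma Zforest_ucm T N : Zf (ucm T) N = Zt T N.
Proof. by rewrite /Zforest trees_ucm big_seq1. Qed.

Lemma leval_Zforest_BplusL a x N : leval (Zf ^~ N) (BplusL a x) =
  \sum_(1 <= n < N + ~~ b) n%:R ^- val a * leval (Zf ^~ n) x.
Proof.
rewrite leval_linext !levalE.
transitivity (\sum_(1 <= n < N + ~~ b) \sum_(F <- msupp x)
    mcoeff F x * (n%:R ^- val a * Zf F n)).
  rewrite exchange_big; apply: eq_bigr => F _ /=.
  by rewrite leval_basis Zforest_ucm Ztree_BplusE mulr_sumr.
apply: eq_bigr => n _; rewrite levalE mulr_sumr; apply: eq_bigr => F _.
by rewrite mulrCA.
Qed.

Lemma Zforest_Baxter a1 a2 F1 F2 N :
  Zf (ucm (Bplus a1 F1)) N * Zf (ucm (Bplus a2 F2)) N =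
    Zf (ucm (Bplus a1 (mmul F1 (ucm (Bplus a2 F2))))) N
    + Zf (ucm (Bplus a2 (mmul (ucm (Bplus a1 F1)) F2))) N
    + (-1) ^+ (~~ b) * Zf (ucm (Bplus (posnat_add a1 a2) (mmul F1 F2))) N.
Proof.
rewrite 5!Zforest_ucm 5!Ztree_BplusE (truncated_sumM b).
congr (_ + _ + _ * _); apply: eq_bigr => n _; rewrite !Zforest_mmul.
- by rewrite Zforest_ucm Ztree_BplusE mulrA.
- by rewrite Zforest_ucm Ztree_BplusE -mulrA [X in _ * X]mulrC.
- by rewrite /= exprD invfM mulrACA.
Qed.

Lemma leval_Zforest_associator x y z N :
  leval (Zf ^~ N) (associator posnat_add ((-1) ^+ (~~ b)) x y z) = 0.
Proof.
refine (@leval_associator R posnat posnat_add _ nat setT (fun N F => Zf F N) _ _ _ _ x y z N I).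
- by move=> n; exact: Zforest_mone.
- by move=> n F F'; exact: Zforest_mmul.
- move=> a u v uv n _; apply: (etrans (leval_Zforest_BplusL a u n)).
  apply: (etrans _ (esym (leval_Zforest_BplusL a v n))).
  by apply: eq_bigr => m _; congr (_ * _); exact: uv.
- by move=> a1 a2 F1 F2 n _; exact: Zforest_Baxter.
Qed.

Lemma Ztree_ge0 T N : 0 <= Zt T N.
Proof.
elim/tree_Bplus_ind: T N => a F IH N; rewrite Ztree_BplusE.
apply: sumr_ge0 => n _; rewrite mulr_ge0 ?invr_ge0 ?exprn_ge0 ?ler0n //.
by rewrite /Zforest big_seq; apply: prodr_ge0 => T /IH.
Qed.

Lemma Zforest_ge0 F N : 0 <= Zf F N.
Proof. by apply: prodr_ge0 => T _; exact: Ztree_ge0. Qed.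

Lemma Ztree_nondecreasing T : nondecreasing_seq (Zt T).
Proof.
rewrite -[T]Bplus_root_children; apply/nondecreasing_seqP => N.
rewrite !Ztree_BplusE; set M := (N + ~~ b)%N.
have -> : (N.+1 + ~~ b = M.+1)%N by rewrite addSn.
case: M => [|M]; first by rewrite !big_geq.
rewrite (@sum1_recr _ _ M.+1) // lerDl mulr_ge0 ?Zforest_ge0 ?invr_ge0 ?exprn_ge0 //.
Qed.

Lemma Ztree_Bplus_le a F N :
  Zt (Bplus a F) N <= \sum_(1 <= n < N.+1) n%:R ^- val a * Zf F n.
Proof.
rewrite Ztree_BplusE; case: (~~ b); rewrite /= ?addn1 ?addn0 //.
case: N => [|N]; first by rewrite !big_geq.
rewrite (@sum1_recr _ _ N.+1) // lerDl mulr_ge0 ?Zforest_ge0 ?invr_ge0 ?exprn_ge0 //.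
Qed.

(** Crude, but valid for all forests, and enough below a root of decoration at
    least 2. *)
Lemma Zforest_le_harmonic F N : Zf F N <= harmonic_sum R N ^+ forest_size F.
Proof.
suff HT T : Zt T N <= harmonic_sum R N ^+ tree_size T.
  rewrite /Zforest /forest_size; elim: (trees F) => [|T s IH].
    by rewrite big_nil expr0.
  rewrite big_cons /= exprD ler_pM ?Ztree_ge0 ?HT //.
  by apply: prodr_ge0 => ? _; exact: Ztree_ge0.
elim/tree_Bplus_ind: T N => a {}F IH N; rewrite tree_size_Bplus.
apply: le_trans (Ztree_Bplus_le _ _ _) _.
rewrite exprSr [X in _ * X]/harmonic_sum mulr_sumr; apply: ler_sum_nat => n /andP[n1 nN].
have n1R : 1 <= n%:R :> R by rewrite ler1n.
have Zle : Zf F n <= harmonic_sum R N ^+ forest_size F.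
  rewrite /Zforest /forest_size; elim: (trees F) IH => [|T s IHs] IH.
    by rewrite big_nil expr0.
  rewrite big_cons /= exprD ler_pM ?Ztree_ge0 //.
  - by apply: prodr_ge0 => ? _; exact: Ztree_ge0.
  - apply: le_trans (IH _ _ n) _; first exact: mem_head.
    rewrite lerXn2r ?nnegrE ?harmonic_sum_ge0 //.
    exact: le_harmonic_sum.
  - by apply: IHs => U Us; apply: IH; rewrite inE Us orbT.
rewrite mulrC ler_pM ?Zforest_ge0 //.
rewrite lef_pV2 ?posrE ?exprn_gt0 ?(lt_le_trans ltr01) //.
by rewrite -[leLHS]expr1 ler_weXn2l // (valP a).
Qed.

Lemma Zforest_cvg F : conv_posnat F -> cvgn (Zf F).
Proof.
move=> /allP cF; rewrite /Zforest.
have : forall T, T \in trees F -> cvgn (Zt T).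
  move=> T /cF; rewrite -[T]Bplus_root_children root_Bplus.
  move: (root T) (children T) => a G a2.
  apply: nondecreasing_is_cvgn; first exact: Ztree_nondecreasing.
  have [C HC] := harmonic_sum_series_bound R (forest_size G).
  exists C => _ [N _ <-]; apply: le_trans (HC N).
  apply: le_trans (Ztree_Bplus_le _ _ _) _.
  apply: ler_sum_nat => n /andP[n1 nN].
  have n1R : 1 <= n%:R :> R by rewrite ler1n.
  rewrite ler_pM ?Zforest_ge0 ?Zforest_le_harmonic ?invr_ge0 ?exprn_ge0 //.
  rewrite lef_pV2 ?posrE ?exprn_gt0 ?(lt_le_trans ltr01) //.
  by rewrite ler_weXn2l.
elim: (trees F) => [|T s IH] cT.
  rewrite (_ : (fun _ => _) = cst 1); first exact: is_cvg_cst.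
  by apply/funext => N; rewrite big_nil.
rewrite (_ : (fun _ => _) = (fun N => Zt T N * \prod_(U <- s) Zt U N)); last first.
  by apply/funext => N; rewrite big_cons.
apply: is_cvgM; first by apply: cT; rewrite mem_head.
by apply: IH => U Us; apply: cT; rewrite inE Us orbT.
Qed.

Lemma zeta_series_associator x y z :
  spanned conv_posnat x -> spanned conv_posnat y -> spanned conv_posnat z ->
  let A := associator posnat_add ((-1) ^+ (~~ b)) x y z : forest_alg R posnat in
  spanned conv_posnat A /\ zeta_series l A = 0.
Proof.
move=> cx cy cz A; have cA : spanned conv_posnat A.
  by apply: spanned_associator => // F F'; exact: shuffle_forest_conv_posnat.
split=> //.
have := @leval_cvg R _ nat \oo (@eventually_filter) (fun F N => Zf F N) (fun F => limn (Zf F)) A.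
have /spannedP {}cA := cA.
move=> /(_ (fun F FA => Zforest_cvg (cA F FA))).
rewrite (_ : (fun N => _) = cst 0); last first.
  by apply/funext => N; exact: leval_Zforest_associator.
move=> lim0; have A0 : 0 = leval (fun F => limn (Zf F)) A.
  by rewrite -(cvg_lim (@Rhausdorff R) lim0) lim_cst //; exact: Rhausdorff.
exact: (esym A0).
Qed.

End ZetaSeries.

(** * Primitives on a half-open interval *)

Section Primitives.
Variables (R : realType) (e : R).
Notation mu := (@lebesgue_measure R).
Implicit Types (f g df dg : R -> R).

Definition continuous_from f := forall b, e < b -> b < 1 -> {within `[e, b], continuous f}.

(** On the points [z] with [e <= z < 1], such an [f] is determined by [df] and by its
    value at [e], monotonically in both. This turns identities and
    inequalities between iterated integrals into pointwise statements on the
    integrands. *)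
Definition primitive_from f df :=
  continuous_from f /\ forall z : R, e < z -> z < 1 -> is_derive z 1 f (df z).

Lemma continuous_from_cst c : continuous_from (fun=> c).
Proof. by move=> b _ _; apply: continuous_subspaceT => x; exact: cvg_cst. Qed.

Lemma continuous_fromM f g : continuous_from f -> continuous_from g ->
  continuous_from (fun z => f z * g z).
Proof. by move=> cf cg b eb b1 x; apply: cvgM; [exact: cf|exact: cg]. Qed.

Lemma primitive_from_cst c : primitive_from (fun=> c) (fun=> 0).
Proof. by split; [exact: continuous_from_cst|move=> z _ _; exact: is_derive_cst]. Qed.

Lemma primitive_fromD f g df dg : primitive_from f df -> primitive_from g dg ->
  primitive_from (fun z => f z + g z) (fun z => df z + dg z).
Proof.
move=> [cf ff] [cg gg]; split=> [b eb b1|z ez z1].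
  by apply: (@within_continuousD _ _ _ _ f g); [exact: cf|exact: cg].
by have := ff z ez z1; have := gg z ez z1 => ? ?; exact: is_deriveD.
Qed.

Lemma primitive_fromM f g df dg : primitive_from f df -> primitive_from g dg ->
  primitive_from (fun z => f z * g z) (fun z => f z * dg z + df z * g z).
Proof.
move=> [cf ff] [cg gg]; split; first exact: continuous_fromM.
move=> z ez z1; have := ff z ez z1; have := gg z ez z1 => Dg Df.
apply: (@is_derive_eq _ _ _ _ _ _ _ _ (@is_deriveM _ _ f g z 1 _ _ Df Dg)).
by rewrite /GRing.scale /= [X in _ + X]mulrC.
Qed.

Lemma primitive_fromZ f df c : primitive_from f df ->
  primitive_from (fun z => c * f z) (fun z => c * df z).
Proof.
move=> /(primitive_fromM (primitive_from_cst c)) [cf ff]; split=> // z ez z1.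
by apply: (is_derive_eq (ff z ez z1)); rewrite mul0r addr0.
Qed.

Lemma primitive_fromB f g df dg : primitive_from f df -> primitive_from g dg ->
  primitive_from (fun z => f z - g z) (fun z => df z - dg z).
Proof.
move=> ff /(primitive_fromZ (-1)) gg; have := primitive_fromD ff gg.
rewrite (_ : (fun z => f z + _) = (fun z => f z - g z)).
  rewrite (_ : (fun z => df z + _) = (fun z => df z - dg z)) //.
  by apply/funext => z; rewrite mulN1r.
by apply/funext => z; rewrite mulN1r.
Qed.

Lemma primitive_from_sum (I : Type) (r : seq I) (f df : I -> R -> R) :
  (forall i, primitive_from (f i) (df i)) ->
  primitive_from (fun z => \sum_(i <- r) f i z) (fun z => \sum_(i <- r) df i z).
Proof.
move=> fdf; elim: r => [|i r IH].
  rewrite (_ : (fun z => _) = fun=> 0); last by apply/funext => z; rewrite big_nil.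
  rewrite [X in primitive_from _ X](_ : _ = fun=> 0); last by apply/funext => z; rewrite big_nil.
  exact: primitive_from_cst.
rewrite (_ : (fun z => _) = fun z => f i z + \sum_(i <- r) f i z); last first.
  by apply/funext => z; rewrite big_cons.
rewrite [X in primitive_from _ X](_ : _ = fun z => df i z + \sum_(i <- r) df i z); last first.
  by apply/funext => z; rewrite big_cons.
exact: primitive_fromD.
Qed.

Lemma primitive_from_ge0 f df : primitive_from f df -> 0 <= f e ->
  (forall z, e < z -> z < 1 -> 0 <= df z) -> forall z, e <= z -> z < 1 -> 0 <= f z.
Proof.
move=> [cf ff] fe df0 z; rewrite le_eqVlt => /predU1P[<- //|ez] z1.
have /MVT : forall x, x \in `]e, z[%R -> is_derive x 1 f (df x).
  by move=> x; rewrite in_itv /= => /andP[ex xz]; apply: ff => //; exact: lt_trans z1.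
move=> /(_ ez (cf z ez z1)) [c]; rewrite in_itv /= => /andP[ec cz] fz.
have c0 : 0 <= df c by apply: df0 => //; exact: lt_trans z1.
by rewrite -(subrK (f e) (f z)) fz addr_ge0 // mulr_ge0 // subr_ge0 ltW.
Qed.

Lemma primitive_from_le f g df dg : primitive_from f df -> primitive_from g dg ->
  f e <= g e -> (forall z, e < z -> z < 1 -> df z <= dg z) ->
  forall z, e <= z -> z < 1 -> f z <= g z.
Proof.
move=> ff gg fge dfg z ez z1; rewrite -subr_ge0.
apply: (primitive_from_ge0 (primitive_fromB gg ff)) => //.
  by rewrite subr_ge0.
by move=> x ex x1; rewrite subr_ge0; exact: dfg.
Qed.

Lemma primitive_from_eq f g df dg : primitive_from f df -> primitive_from g dg ->
  f e = g e -> (forall z, e < z -> z < 1 -> df z = dg z) ->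
  forall z, e <= z -> z < 1 -> f z = g z.
Proof.
move=> ff gg fge dfg z ez z1; apply/eqP; rewrite eq_le.
rewrite (primitive_from_le ff gg) ?fge // => [|x ex x1]; last by rewrite dfg.
by rewrite (primitive_from_le gg ff) ?fge // => x ex x1; rewrite dfg.
Qed.

Lemma integral_primitive_from f : continuous_from f ->
  primitive_from (fun z => \int[mu]_(t in `[e, z]) f t) f.
Proof.
move=> cf; have intf b : e < b -> b < 1 -> mu.-integrable `[e, b] (EFin \o f).
  by move=> eb b1; apply: continuous_compact_integrable; [exact: segment_compact|exact: cf].
split=> [b eb b1|z ez z1].
  by apply: parameterized_integral_continuous; [exact: ltW|exact: intf].
(* Differentiability at [z] needs integrability slightly beyond [z]. *)
pose u := (z + 1) / 2.
have zu : z < u by rewrite /u; lra.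
have u1 : u < 1 by rewrite /u; lra.
have eu : e < u := lt_trans ez zu.
have [||dF F'] := @continuous_FTC1 R f (BLeft e) z u zu (intf u eu u1).
- exact: ez.
- apply: (@within_continuous_continuous _ _ _ e u _ _ eu (cf u eu u1)).
  by rewrite in_itv /= ez.
apply: DeriveDef.
  exact: dF.
rewrite -derive1E.
exact: F'.
Qed.

End Primitives.

(** * Truncated iterated integrals *)

Section TruncatedIntegrals.
Variable R : realType.
Implicit Types (e z t : R) (w : letter) (F : forest letter) (T : tree letter).

Lemma sigma_ge0 w t : 0 < t -> t < 1 -> 0 <= sigma w t.
Proof. by move=> t0 t1; case: w; rewrite /= invr_ge0; lra. Qed.

Lemma continuous_from_sigma e w : 0 < e -> continuous_from e (sigma w : R -> R).
Proof.
move=> e0 b eb b1; apply: continuous_in_subspaceT => t; rewrite inE /= in_itv /= => /andP[et tb].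
case: w; rewrite /sigma.
- apply: (@cvgV R R) => //; first by rewrite gt_eqF //; lra.
- apply: (@cvgV R R); first by rewrite gt_eqF //; lra.
  by apply: cvgB; [exact: cvg_cst|exact: cvg_id].
Qed.

Section Fixed.
Variable e : R.
Hypothesis e0 : 0 < e.

Lemma Atree_start T : Atree e T e = 0.
Proof.
rewrite -[T]Bplus_root_children Atree_Bplus set_itv1.
by rewrite Rintegral_set1.
Qed.

Lemma Aforest_continuous_from_trees (F : forest letter) :
  (forall T, T \in trees F -> continuous_from e (Atree e T)) ->
  continuous_from e (Aforest e F).
Proof.
rewrite /Aforest; elim: (trees F) => [|T s IH] cT.
  rewrite (_ : (fun _ => _) = fun=> 1); first exact: continuous_from_cst.
  by apply/funext => z; rewrite big_nil.
rewrite (_ : (fun _ => _) = fun z => Atree e T z * \prod_(U <- s) Atree e U z); last first.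
  by apply/funext => z; rewrite big_cons.
apply: continuous_fromM; first by apply: cT; rewrite mem_head.
by apply: IH => U Us; apply: cT; rewrite inE Us orbT.
Qed.

Lemma Atree_primitive_from_Aforest w F : continuous_from e (Aforest e F) ->
  primitive_from e (Atree e (Bplus w F)) (fun t => sigma w t * Aforest e F t).
Proof.
move=> cF; rewrite (_ : Atree e _ =
    fun z => \int[lebesgue_measure]_(t in `[e, z]) (sigma w t * Aforest e F t)).
  by apply: integral_primitive_from; apply: continuous_fromM => //; exact: continuous_from_sigma.
by apply/funext => z; rewrite Atree_Bplus.
Qed.

Lemma Aforest_continuous_from F : continuous_from e (Aforest e F).
Proof.
apply: Aforest_continuous_from_trees => T _.
elim/tree_Bplus_ind: T => w {}F IH.
by have [] := Atree_primitive_from_Aforest w (Aforest_continuous_from_trees IH).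
Qed.

Lemma Atree_primitive w F :
  primitive_from e (Atree e (Bplus w F)) (fun t => sigma w t * Aforest e F t).
Proof. exact/Atree_primitive_from_Aforest/Aforest_continuous_from. Qed.

Lemma Aforest_ucm T z : Aforest e (ucm T) z = Atree e T z.
Proof. by rewrite /Aforest trees_ucm big_seq1. Qed.

Lemma BplusL_primitive a x : primitive_from e
  (fun z => leval (Aforest e ^~ z) (BplusL a x))
  (fun z => sigma a z * leval (Aforest e ^~ z) x).
Proof.
have := primitive_from_sum (msupp x)
  (fun F => primitive_fromZ (mcoeff F x) (Atree_primitive a F)).
congr primitive_from; apply/funext => z.
  rewrite leval_linext levalE; apply: eq_bigr => F _.
  by rewrite leval_basis Aforest_ucm.
rewrite levalE mulr_sumr; apply: eq_bigr => F _; exact: mulrCA.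
Qed.

(** Integration by parts: both sides vanish at [e] and have the same derivative. *)
Lemma Aforest_Baxter a b F F' z : e <= z -> z < 1 ->
  Aforest e (ucm (Bplus a F)) z * Aforest e (ucm (Bplus b F')) z =
    Aforest e (ucm (Bplus a (mmul F (ucm (Bplus b F'))))) z
    + Aforest e (ucm (Bplus b (mmul (ucm (Bplus a F)) F'))) z.
Proof.
move=> ez z1; rewrite !Aforest_ucm; move: z ez z1.
apply: (primitive_from_eq (primitive_fromM (Atree_primitive a F) (Atree_primitive b F'))
  (primitive_fromD (Atree_primitive a _) (Atree_primitive b _))).
  by rewrite !Atree_start mulr0 addr0.
move=> z ez z1; rewrite !Aforest_mmul !Aforest_ucm; ring.
Qed.

Lemma leval_Aforest_associator x y u z : e <= z -> z < 1 ->
  leval (Aforest e ^~ z) (associator letter_law 0 x y u) = 0.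
Proof.
move=> ez z1.
refine (@leval_associator R letter letter_law 0 R [set t | e <= t < 1]
  (fun z F => Aforest e F z) _ _ _ _ x y u z _); last by rewrite /= ez z1.
- by move=> t; exact: Aforest_mone.
- by move=> t F F'; exact: Aforest_mmul.
- move=> a v v' vv' t /andP[et t1].
  have start v0 : leval (Aforest e ^~ e) (BplusL a v0) = 0.
    rewrite leval_linext levalE; apply: big1 => F _.
    by rewrite leval_basis Aforest_ucm Atree_start mulr0.
  refine (primitive_from_eq (BplusL_primitive a v) (BplusL_primitive a v') _ _ et t1).
    by apply: (etrans (start v)); exact: (esym (start v')).
  move=> s es s1; have vs : e <= s < 1 by rewrite ltW.
  exact: (f_equal ( *%R (sigma a s)) (vv' s vs)).
- by move=> a b F F' t /andP[et t1]; rewrite mul0r addr0; exact: Aforest_Baxter.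
Qed.

Lemma Atree_ge0 T z : e <= z -> z < 1 -> 0 <= Atree e T z.
Proof.
elim/tree_Bplus_ind: T z => w F IH.
apply: (primitive_from_ge0 (Atree_primitive w F)); first by rewrite Atree_start.
move=> z ez z1; rewrite mulr_ge0 ?sigma_ge0 //; first exact: lt_trans ez.
by rewrite /Aforest big_seq; apply: prodr_ge0 => T /IH; apply => //; exact: ltW.
Qed.

Lemma Aforest_ge0 F z : e <= z -> z < 1 -> 0 <= Aforest e F z.
Proof. by move=> ez z1; apply: prodr_ge0 => T _; exact: Atree_ge0. Qed.

End Fixed.
End TruncatedIntegrals.

(** * Bounds on iterated integrals uniform in the truncation *)

Section Bounds.
Variable R : realType.
Implicit Types (e z t d p : R) (w : letter) (F : forest letter) (T : tree letter).

Lemma is_derive_primitive_from e (f df : R -> R) :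
  (forall z : R, e <= z -> z < 1 -> is_derive z 1 f (df z)) -> primitive_from e f df.
Proof.
move=> dfP; split=> [b eb b1|z ez z1]; last by apply: dfP => //; exact: ltW.
apply: derivable_within_continuous => z; rewrite in_itv /= => /andP[ez zb].
by have [] := dfP z ez (le_lt_trans zb b1).
Qed.

Lemma primitive_from_id e : primitive_from e id (fun=> 1).
Proof. by apply: is_derive_primitive_from => z _ _; exact: is_derive_id. Qed.

Lemma primitive_from_powR e p :
  primitive_from e (fun t => (1 - t) `^ p) (fun t => - (p * (1 - t) `^ (p - 1))).
Proof.
apply: is_derive_primitive_from => z _ z1.
have Ds : is_derive z 1 (fun t : R => 1 - t) (-1).
  have := is_deriveB (is_derive_cst (1 : R) z 1) (is_derive_id z 1).
  by move=> H; apply: (is_derive_eq H); rewrite sub0r.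
have Dp : is_derive (1 - z) 1 (@powR R ^~ p) (p * (1 - z) `^ (p - 1)).
  by apply: is_derive1_powR; rewrite subr_gt0.
have -> : - (p * (1 - z) `^ (p - 1)) = p * (1 - z) `^ (p - 1) * -1 by rewrite mulrN1.
exact: (@is_derive1_comp R (fun s => s `^ p) (fun t => 1 - t) z _ _ Dp Ds).
Qed.

(** The factor [t] compensates the singularity of [1 / t] at 0, and the factor
    [(1 - t) ^ (- d)] with [d] arbitrarily small absorbs the logarithms at 1. *)
Definition bounded_by_powR (f : R -> R -> R) d := exists2 C, 0 <= C &
  forall e t, 0 < e -> e <= t -> t < 1 -> f e t <= C * (t * (1 - t) `^ (- d)).

(** The exponents of the trees of a forest add up, hence the halving of [d]; as
    the forest is not empty, one factor [t] survives. *)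
Lemma Aforest_bounded_by_powR F : trees F <> [::] ->
  (forall T, T \in trees F -> forall d, 0 < d -> d <= 1 ->
    bounded_by_powR (fun e => Atree e T) d) ->
  forall d, 0 < d -> d <= 1 -> bounded_by_powR (fun e => Aforest e F) d.
Proof.
rewrite /Aforest; case: (trees F) => // T s _; elim: s T => [|U s IH] T bT d d0 d1.
  have [C C0 HC] := bT _ (mem_head _ _) d d0 d1; exists C => // e t e0 et t1.
  by rewrite big_seq1; exact: HC.
have [||C C0 HC] := bT T (mem_head _ _) (d / 2); try lra.
have [|||C' C'0 HC'] := IH U _ (d / 2); try lra.
  by move=> V Vs; apply: bT; rewrite inE Vs orbT.
exists (C * C'); first exact: mulr_ge0.
move=> e t e0 et t1; rewrite big_cons.
apply: le_trans (ler_pM _ _ (HC _ _ e0 et t1) (HC' _ _ e0 et t1)) _.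
- exact: Atree_ge0.
- by apply: prodr_ge0 => V _; exact: Atree_ge0.
have q0 : 0 < 1 - t by rewrite subr_gt0.
have -> : (1 - t) `^ (- d) = (1 - t) `^ (- (d / 2)) * (1 - t) `^ (- (d / 2)).
  rewrite (_ : - d = - (d / 2) + - (d / 2)); last by lra.
  by rewrite powRD // (gt_eqF q0) implybT.
have := powR_ge0 (1 - t) (- (d / 2)); set P := _ `^ _ => P0.
have t0 : 0 <= t by lra.
rewrite -subr_ge0 (_ : _ - _ = C * C' * P ^+ 2 * t * (1 - t)); last by ring.
by rewrite !mulr_ge0 ?sqr_ge0 //; lra.
Qed.

(** If the integrand is at most [C (1 - t) ^ (- d - 1)], the integral is at most
    [C / d * t * (1 - t) ^ (- d)], by comparison of derivatives:
    [(1 - t) + d t >= d] when [d <= 1]. The integrand has this size below a root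
    [y] for any forest of children, and below a root [x] because there the
    children contribute a factor [t]. *)
Lemma Atree_bounded_by_powR T : leaves_branchings_y T ->
  forall d, 0 < d -> d <= 1 -> bounded_by_powR (fun e => Atree e T) d.
Proof.
elim/tree_Bplus_ind: T => w F IH; rewrite leaves_branchings_y_Bplus => /andP[/allP yF wF].
move=> d d0 d1.
have [C C0 HC] : exists2 C, 0 <= C & forall e t, 0 < e -> e <= t -> t < 1 ->
    sigma w t * Aforest e F t <= C * ((1 - t) `^ (- d) * (1 - t)^-1).
  have P1 t : 0 < t -> t < 1 -> 1 <= (1 - t) `^ (- d).
    move=> t0 t1; rewrite -[leLHS](powRr0 (1 - t)) ger_powR //; lra.
  have V1 t : 0 < t -> t < 1 -> 1 <= (1 - t)^-1.
    by move=> t0 t1; rewrite invf_ge1; lra.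
  case: (eqVneq (trees F) [::]) wF => [F0|F0].
    rewrite F0 => /eqP ->; exists 1 => // e t e0 et t1.
    have t0 : 0 < t by lra.
    rewrite /Aforest F0 big_nil /sigma mul1r mulr1 ler_peMl ?P1 //.
    by rewrite invr_ge0; lra.
  move=> _; have [|C C0 HC] := Aforest_bounded_by_powR (elimN eqP F0) _ d0 d1.
    by move=> T TF; apply: IH => //; exact: yF.
  exists C => // e t e0 et t1; have t0 : 0 < t by lra.
  apply: le_trans (ler_wpM2l (sigma_ge0 w t0 t1) (HC e t e0 et t1)) _.
  have := powR_ge0 (1 - t) (- d); set P := _ `^ _ => P0.
  have := V1 _ t0 t1; case: (w); rewrite /sigma => Vt.
    rewrite mulrCA mulKf ?gt_eqF // ler_wpM2l // ler_peMr //.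
  have V0 := le_trans ler01 Vt.
  rewrite mulrCA ler_wpM2l // mulrA [leRHS]mulrC ler_wpM2r //.
  by rewrite ler_piMr // ltW.
exists (C / d); first by rewrite divr_ge0 // ltW.
move=> e t e0 et t1; have e1 := le_lt_trans et t1.
have H := primitive_fromZ (C / d)
  (primitive_fromM (primitive_from_id e) (primitive_from_powR e (- d))).
apply: (primitive_from_le (Atree_primitive e0 w F) H) => //.
  by rewrite Atree_start !mulr_ge0 ?powR_ge0 ?invr_ge0 // ltW.
move=> z ez z1; apply: le_trans (HC e z e0 (ltW ez) z1) _.
have q0 : 0 < 1 - z by rewrite subr_gt0.
rewrite powRB ?(gt_eqF q0) ?implybT // (powRr1 (ltW q0)).
have := powR_ge0 (1 - z) (- d); set P := _ `^ _ => P0.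
rewrite -subr_ge0 (_ : _ - _ = C / d * P / (1 - z) * ((1 - d) * (1 - z))); last first.
  by field; rewrite !gt_eqF.
have z0 : 0 < z by lra.
by rewrite !mulr_ge0 ?invr_ge0 //; lra.
Qed.

(** Below a root [x] the factor [t] cancels [1 / t], and what remains,
    [C (1 - t) ^ (- 1 / 2)], is integrable up to 1. *)
Lemma Atree_conv_bounded T : root T = letter_x -> leaves_branchings_y T ->
  exists C, forall e t, 0 < e -> e <= t -> t < 1 -> Atree e T t <= C.
Proof.
rewrite -[T]Bplus_root_children root_Bplus => ->; move: (children T) => F.
rewrite leaves_branchings_y_Bplus => /andP[/allP yF wF].
have h2 : 0 < 2^-1 :> R by lra.
have F0 : trees F <> [::] by move=> F0; rewrite F0 in wF.
have [U UF||C C0 HC] := Aforest_bounded_by_powR F0 _ h2.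
- by apply: Atree_bounded_by_powR; exact: yF.
- lra.
exists (2 * C) => e t e0 et t1; have e1 := le_lt_trans et t1.
(* The majorant is [2 C - 2 C (1 - t) ^ (1 / 2)]. *)
have H := primitive_fromD (primitive_from_cst e (2 * C))
  (primitive_fromZ (- (2 * C)) (primitive_from_powR e 2^-1)).
have le1 z : 0 < z -> z < 1 -> (1 - z) `^ 2^-1 <= 1.
  by move=> z0 z1; rewrite -[leRHS](powRr0 (1 - z)) ger_powR //; lra.
apply: le_trans (primitive_from_le (Atree_primitive e0 letter_x F) H _ _ et t1) _.
- rewrite Atree_start mulNr subr_ge0 ler_piMr ?le1 //; lra.
- move=> z ez z1; have z0 : 0 < z by lra.
  apply: le_trans (ler_wpM2l (sigma_ge0 _ z0 z1) (HC e z e0 (ltW ez) z1)) _.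
  rewrite /sigma mulrCA mulKf ?gt_eqF // (_ : 2^-1 - 1 = - 2^-1); last by field.
  by rewrite add0r; move: (_ `^ _) => P; lra.
- by rewrite mulNr gerBl mulr_ge0 ?powR_ge0 //; lra.
Qed.

Lemma Aforest_conv_bounded F : conv_letter F ->
  exists C, forall e t, 0 < e -> e <= t -> t < 1 -> Aforest e F t <= C.
Proof.
rewrite /conv_letter /Aforest; elim: (trees F) => [|T s IH] /=.
  by move=> _; exists 1 => e t _ _ _; rewrite big_nil.
move=> /andP[/andP[/eqP rT yT] /IH[C HC]].
have [C' HC'] := Atree_conv_bounded rT yT.
exists (C' * C) => e t e0 et t1; rewrite big_cons ler_pM ?HC ?HC' //.
  exact: Atree_ge0.
by apply: prodr_ge0 => V _; exact: Atree_ge0.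
Qed.

Lemma primitive_from_start e e' (f df : R -> R) : e <= e' ->
  primitive_from e f df -> primitive_from e' f df.
Proof.
move=> ee' [cf ff]; split=> [b e'b b1|z e'z z1]; last by apply: ff => //; exact: le_lt_trans e'z.
apply: continuous_subspaceW (cf b (le_lt_trans ee' e'b) b1).
by apply: subset_itvr; rewrite bnd_simp.
Qed.

Lemma Atree_nondecreasing e T z z' : 0 < e -> e <= z -> z <= z' -> z' < 1 ->
  Atree e T z <= Atree e T z'.
Proof.
move=> e0 ez zz' z'1; have e1 : e < 1 by lra.
rewrite -[T]Bplus_root_children; move: (root T) (children T) => w F.
have H := primitive_from_start ez (Atree_primitive e0 w F).
apply: (primitive_from_le (primitive_from_cst z _) H _ _ zz' z'1) => // t zt t1.
have et := le_lt_trans ez zt.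
by rewrite mulr_ge0 ?sigma_ge0 ?Aforest_ge0 //; [exact: lt_trans et|exact: ltW].
Qed.

Lemma Atree_nonincreasing_start e e' T z : 0 < e -> e <= e' -> e' <= z -> z < 1 ->
  Atree e' T z <= Atree e T z.
Proof.
move=> e0 ee'; have e'0 := lt_le_trans e0 ee'.
elim/tree_Bplus_ind: T z => w F IH z e'z z1.
have H := primitive_from_start ee' (Atree_primitive e0 w F).
apply: (primitive_from_le (Atree_primitive e'0 w F) H _ _ e'z z1).
  by rewrite Atree_start Atree_ge0 //; lra.
move=> t e't t1; rewrite ler_wpM2l ?sigma_ge0 //; first exact: lt_trans e't.
rewrite /Aforest big_seq [leRHS]big_seq; apply: ler_prod => T TF.
by rewrite Atree_ge0 ?IH // ltW.
Qed.

Lemma Aforest_nondecreasing e F z z' : 0 < e -> e <= z -> z <= z' -> z' < 1 ->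
  Aforest e F z <= Aforest e F z'.
Proof.
move=> e0 ez zz' z'1; apply: ler_prod => T _.
by rewrite Atree_nondecreasing // Atree_ge0 //; lra.
Qed.

Lemma Aforest_nonincreasing_start e e' F z : 0 < e -> e <= e' -> e' <= z -> z < 1 ->
  Aforest e' F z <= Aforest e F z.
Proof.
move=> e0 ee' e'z z1; apply: ler_prod => T _.
by rewrite Atree_nonincreasing_start // Atree_ge0 //; lra.
Qed.

End Bounds.

(** * Integral values *)

Section ZetaIntegrals.
Variable R : realType.
Implicit Types (e z : R) (F : forest letter).

Definition Aforest_lim F z : R := lim (Aforest e F z @[e --> 0^'+]).

Lemma Aforest_cvg F z : conv_letter F -> 0 < z -> z < 1 ->
  Aforest e F z @[e --> 0^'+] --> Aforest_lim F z.
Proof.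
move=> cF z0 z1; have [C HC] := Aforest_conv_bounded R cF.
apply: nonincreasing_at_right_is_cvgr; near=> x.
  have xz : x < z by near: x; exact: nbhs_right_lt.
  move=> e e'; rewrite !in_itv /= => /andP[e0 ex] /andP[e'0 e'x] ee'.
  by apply: Aforest_nonincreasing_start => //; lra.
have xz : x < z by near: x; exact: nbhs_right_lt.
exists C => _ [e + <-]; rewrite /= in_itv /= => /andP[e0 ex].
by apply: HC => //; lra.
Unshelve. all: by end_near. Qed.

Lemma Aforest_lim_cvg F : conv_letter F ->
  Aforest_lim F z @[z --> 1^'-] --> lim (Aforest_lim F z @[z --> 1^'-]).
Proof.
move=> cF; have [C HC] := Aforest_conv_bounded R cF.
apply: nondecreasing_at_left_is_cvgr; near=> x.
  have x0 : 0 < x by near: x; exact: nbhs_left_gt.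
  move=> z z'; rewrite !in_itv /= => /andP[xz z1] /andP[xz' z'1] zz'.
  have z0 : 0 < z by lra.
  have z'0 : 0 < z' by lra.
  apply: ler_lim; [exact/cvgP/Aforest_cvg|exact/cvgP/Aforest_cvg|].
  near=> e; have ez : e < z by near: e; exact: nbhs_right_lt.
  by apply: Aforest_nondecreasing => //; exact: ltW.
have x0 : 0 < x by near: x; exact: nbhs_left_gt.
exists C => _ [z + <-]; rewrite /= in_itv /= => /andP[xz z1].
have z0 : 0 < z by lra.
apply: limr_le; first exact/cvgP/Aforest_cvg.
near=> e; have ez : e < z by near: e; exact: nbhs_right_lt.
by apply: HC => //; exact: ltW.
Unshelve. all: by end_near. Qed.

Lemma zeta_sh_associator (x y u : forest_alg R letter) :
  spanned conv_letter x -> spanned conv_letter y -> spanned conv_letter u ->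
  ker_zeta_sh (associator letter_law 0 x y u).
Proof.
move=> cx cy cu; set A := associator _ _ _ _ _.
have cA : spanned conv_letter A.
  by apply: spanned_associator => // F F'; exact: shuffle_forest_conv_letter.
split=> //; have /spannedP {}cA := cA.
have A_z z : 0 < z -> z < 1 -> leval (Aforest_lim ^~ z) A = 0.
  move=> z0 z1.
  have limA : leval (Aforest e ^~ z) A @[e --> 0^'+] --> leval (Aforest_lim ^~ z) A.
    by apply: (@leval_cvg R _ R _ _ (fun F e => Aforest e F z)) => F FA;
      exact: Aforest_cvg (cA F FA) z0 z1.
  have lim0 : leval (Aforest e ^~ z) A @[e --> 0^'+] --> (0 : R).
    apply: cvg_near_cst; near=> e.
    have e0 : 0 < e by near: e; exact: nbhs_right_gt.
    have ez : e < z by near: e; exact: nbhs_right_lt.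
    exact: (leval_Aforest_associator e0 x y u (ltW ez) z1).
  apply: (cvg_unique _ limA lim0); exact: Rhausdorff.
have limA : leval (Aforest_lim ^~ z) A @[z --> 1^'-] -->
    leval (fun F => lim (Aforest_lim F z @[z --> 1^'-])) A.
  by apply: leval_cvg => F FA; exact: Aforest_lim_cvg (cA F FA).
have lim0 : leval (Aforest_lim ^~ z) A @[z --> 1^'-] --> (0 : R).
  by apply: cvg_near_cst; near=> z; apply: A_z.
apply: (cvg_unique _ limA lim0); exact: Rhausdorff.
Unshelve. all: by end_near. Qed.

End ZetaIntegrals.


Theorem corollary5p13 (R : realType) :
  (forall F1 F2 F3 : forest_alg R posnat,
     spanned conv_posnat F1 -> spanned conv_posnat F2 -> spanned conv_posnat F3 ->
     ker_zeta_st (associator posnat_add 1 F1 F2 F3)) /\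
  (forall F1 F2 F3 : forest_alg R posnat,
     spanned conv_posnat F1 -> spanned conv_posnat F2 -> spanned conv_posnat F3 ->
     ker_zeta_st_star (associator posnat_add (-1) F1 F2 F3)) /\
  (forall f1 f2 f3 : forest_alg R letter,
     spanned conv_letter f1 -> spanned conv_letter f2 -> spanned conv_letter f3 ->
     ker_zeta_sh (associator letter_law 0 f1 f2 f3)).
Proof.
split; [|split].
- by move=> F1 F2 F3; exact: (@zeta_series_associator R true).
- by move=> F1 F2 F3; exact: (@zeta_series_associator R false).
- exact: zeta_sh_associator.
Qed.
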